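(* Let $T:l_\infty\to l_\infty$ be a continuous positive linear map with adjoint $T^*$, let $F=\{p\in\Delta^\sigma: p\text{ is an eigenvector of }T^*\}$ and let $\overline F$ be its weak$^\star$ closure. If $\succsim$ satisfies Weak order, Monotonicity, Continuity, ICRP, Convexity, Monotone continuity and I$T$IS, then there exists a grounded, weak$^\star$-lower semicontinuous function $c:\overline F\to[0,\infty]$ with $c(p)=\infty$ for all $p\in\overline F\setminus F$, such that $$I(x)=\min_{p\in\overline F}\{\langle x,p\rangle+c(p)\}$$ (equivalently, the minimum over $p\in F$ of $\sum_{n\ge0}p_nx_n+c(p)$) is the unique constant equivalent representing $\succsim$. Conversely, if $I$ has this form for some such $c$ and $\langle1,T^*(p)\rangle\le1$ for every $p\in F$, then the relation represented by $I$ satisfies Weak order, Monotonicity, Continuity, ICRP, Convexity, Monotone continuity and I$T$IS.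
   Context: $l_\infty$: real bounded sequences indexed by $\mathbb N$; $\theta\in\mathbb R$ also a constant sequence; $x\ge y$ coordinatewise. $ba(\mathbb N)$: norm dual of $l_\infty$, pairing $\langle x,\mu\rangle$, weak$^\star$ topology. Adjoint: $\langle x,T^*(\mu)\rangle=\langle T(x),\mu\rangle$. $\Delta$: finitely additive probability measures on $2^{\mathbb N}$; $\Delta^\sigma\subseteq\Delta$: countably additive ones, identified with $(p_n)$, $p_n=p(\{n\})\ge0$, $\sum p_n=1$. Eigenvector: nonzero $\mu$ with $T^*\mu=\lambda\mu$ for some real $\lambda$. Grounded: infimum $0$. Constant equivalent: $I$ with $x\sim I(x)$, $x\succsim y\iff I(x)\ge I(y)$. $xAy$ equals $x$ on $A$, $y$ off $A$; $(E_n)\downarrow\emptyset$: decreasing with empty intersection. Weak order: complete, transitive. Monotonicity: $x\ge y\Rightarrow x\succsim y$, $1\succ0$. Continuity: for $x\succsim y\succsim z$ the sets $\{\alpha\in[0,1]:\alpha x+(1-\alpha)z\succsim y\}$, $\{\alpha:y\succsim\alpha x+(1-\alpha)z\}$ are closed. ICRP: $x\succsim y\Rightarrow x+\theta\succsim y+\theta$. Convexity: $x\succsim\theta,y\succsim\theta\Rightarrow\lambda x+(1-\lambda)y\succsim\theta$. Monotone continuity: if $x\succ\theta$ and $(E_n)\downarrow\emptyset$, then for every $k\in\mathbb R$ there is $n_0$ with $kE_{n_0}x\succ\theta$. I$T$IS: $x+d\succsim x\Rightarrow x+T(d)\succsim x$. *)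

(* Defs.v *)
From Stdlib Require Import Reals List.
From Stdlib Require Import Rtopology.
From Coquelicot Require Import Coquelicot.
Open Scope R_scope.

Definition seqR := nat -> R.
Definition in_linf (x : seqR) : Prop := exists M : R, forall n, Rabs (x n) <= M.

Definition cst (t : R) : seqR := fun _ => t.
Definition sge (x y : seqR) : Prop := forall n, y n <= x n.
Definition sadd (x y : seqR) : seqR := fun n => x n + y n.
Definition smix (a : R) (x z : seqR) : seqR := fun n => a * x n + (1 - a) * z n.
Definition splice (A : nat -> bool) (x y : seqR) : seqR :=
  fun n => if A n then x n else y n.

Definition cont_pos_linear (T : seqR -> seqR) : Prop :=
  (forall x, in_linf x -> in_linf (T x)) /\
  (forall x y a b, in_linf x -> in_linf y ->
     forall n, T (fun k => a * x k + b * y k) n = a * T x n + b * T y n) /\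
  (forall x, in_linf x -> sge x (cst 0) -> sge (T x) (cst 0)) /\
  (forall x, in_linf x -> forall eps, 0 < eps -> exists delta, 0 < delta /\
     forall y, in_linf y -> (forall n, Rabs (x n - y n) <= delta) ->
       forall n, Rabs (T x n - T y n) <= eps).

Definition in_ba (phi : seqR -> R) : Prop :=
  (forall x y a b, in_linf x -> in_linf y ->
     phi (fun k => a * x k + b * y k) = a * phi x + b * phi y) /\
  (exists K, forall x M, in_linf x -> (forall n, Rabs (x n) <= M) ->
     Rabs (phi x) <= K * M).

Definition in_Delta_sigma (p : seqR) : Prop :=
  (forall n, 0 <= p n) /\ is_series p 1.
Definition pair (x p : seqR) : R := Series (fun n => p n * x n).

(** F = {p in Delta^sigma : p is an eigenvector of T^*},
    T^* p = lambda p  means  <T x, p> = lambda <x, p> for all x in l_infty *)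
Definition inF (T : seqR -> seqR) (p : seqR) : Prop :=
  in_Delta_sigma p /\
  exists lambda : R, forall x, in_linf x -> pair (T x) p = lambda * pair x p.

(** the functional of ba(N) corresponding to p is x |-> <x,p>;
    phi "is" an element of F if it coincides on l_infty with such a functional *)
Definition is_in_F (T : seqR -> seqR) (phi : seqR -> R) : Prop :=
  exists p, inF T p /\ forall x, in_linf x -> phi x = pair x p.

Definition wnbhd (xs : list seqR) (eps : R) (phi psi : seqR -> R) : Prop :=
  forall x, In x xs -> Rabs (psi x - phi x) < eps.

Definition in_Fbar (T : seqR -> seqR) (phi : seqR -> R) : Prop :=
  in_ba phi /\
  forall (xs : list seqR) (eps : R), List.Forall in_linf xs -> 0 < eps ->
    exists p, inF T p /\ wnbhd xs eps phi (fun x => pair x p).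

Definition good_cost (T : seqR -> seqR) (c : (seqR -> R) -> Rbar) : Prop :=
  (forall phi, in_Fbar T phi -> Rbar_le (Finite 0) (c phi)) /\
  (* grounded: infimum over Fbar equals 0 *)
  (forall eps, 0 < eps -> exists phi, in_Fbar T phi /\ Rbar_lt (c phi) (Finite eps)) /\
  (forall phi, in_Fbar T phi -> forall t : R, Rbar_lt (Finite t) (c phi) ->
     exists (xs : list seqR) (eps : R), List.Forall in_linf xs /\ 0 < eps /\
       forall psi, in_Fbar T psi -> wnbhd xs eps phi psi -> Rbar_lt (Finite t) (c psi)) /\
  (forall phi, in_Fbar T phi -> ~ is_in_F T phi -> c phi = p_infty).

Definition is_min_rep (T : seqR -> seqR) (c : (seqR -> R) -> Rbar) (I : seqR -> R) : Prop :=
  forall x, in_linf x ->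
    (exists phi, in_Fbar T phi /\ Rbar_plus (Finite (phi x)) (c phi) = Finite (I x)) /\
    (forall psi, in_Fbar T psi -> Rbar_le (Finite (I x)) (Rbar_plus (Finite (psi x)) (c psi))).

Definition spref (pref : seqR -> seqR -> Prop) x y := pref x y /\ ~ pref y x.
Definition indiff (pref : seqR -> seqR -> Prop) x y := pref x y /\ pref y x.

Definition weak_order (pref : seqR -> seqR -> Prop) : Prop :=
  (forall x y, in_linf x -> in_linf y -> pref x y \/ pref y x) /\
  (forall x y z, in_linf x -> in_linf y -> in_linf z ->
     pref x y -> pref y z -> pref x z).
Definition monotonicity (pref : seqR -> seqR -> Prop) : Prop :=
  (forall x y, in_linf x -> in_linf y -> sge x y -> pref x y) /\
  spref pref (cst 1) (cst 0).
Definition continuity (pref : seqR -> seqR -> Prop) : Prop :=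
  forall x y z, in_linf x -> in_linf y -> in_linf z -> pref x y -> pref y z ->
    closed_set (fun a => 0 <= a <= 1 /\ pref (smix a x z) y) /\
    closed_set (fun a => 0 <= a <= 1 /\ pref y (smix a x z)).
Definition icrp (pref : seqR -> seqR -> Prop) : Prop :=
  forall x y (theta : R), in_linf x -> in_linf y -> pref x y ->
    pref (sadd x (cst theta)) (sadd y (cst theta)).
Definition convexity (pref : seqR -> seqR -> Prop) : Prop :=
  forall x y (theta lam : R), in_linf x -> in_linf y -> 0 <= lam <= 1 ->
    pref x (cst theta) -> pref y (cst theta) -> pref (smix lam x y) (cst theta).
Definition decreasing_to_empty (E : nat -> nat -> bool) : Prop :=
  (forall n m, E (S n) m = true -> E n m = true) /\
  (forall m, exists n, E n m = false).
Definition monotone_continuity (pref : seqR -> seqR -> Prop) : Prop :=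
  forall x (theta : R) (E : nat -> nat -> bool), in_linf x ->
    spref pref x (cst theta) -> decreasing_to_empty E ->
    forall k : R, exists n0, spref pref (splice (E n0) (cst k) x) (cst theta).
Definition TIS (pref : seqR -> seqR -> Prop) (T : seqR -> seqR) : Prop :=
  forall x d, in_linf x -> in_linf d -> pref (sadd x d) x -> pref (sadd x (T d)) x.

Definition all_axioms (pref : seqR -> seqR -> Prop) (T : seqR -> seqR) : Prop :=
  weak_order pref /\ monotonicity pref /\ continuity pref /\ icrp pref /\ convexity pref /\
  monotone_continuity pref /\ TIS pref T.

Definition const_equiv (pref : seqR -> seqR -> Prop) (I : seqR -> R) : Prop :=
  (forall x, in_linf x -> indiff pref x (cst (I x))) /\
  (forall x y, in_linf x -> in_linf y -> (pref x y <-> I y <= I x)).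

(* Main.v *)
(** From the axioms to the representation: the constant equivalent [I] is a
    concave niveloid such that [I (x + d) >= I x] implies [I (x + T d) >= I x].
    Its directional derivative [g0] at a point [x] is superlinear and inherits
    this implication, and so do [g1 = g0'(e_0; .)], [g2 = g1'(e_1; .)], ... and
    their increasing limit [G >= g0].  Each differentiation makes the functional
    additive along one more unit sequence, so [G] is additive along all of them;
    monotone continuity makes it vanish on tails, hence [G = <., p>] with [p]
    countably additive.  The implication for [G] says that [<d, p> >= 0] forces
    [<T d, p> >= 0], hence [T^* p = l p].  As [p] is a supergradient of [I] at
    [x], the Fenchel conjugate of [I] is a suitable cost.

    Conversely, only monotone continuity needs more than the minimum formula:
    if it failed, minimizing functionals would have a weak* cluster point in
    Fbar of finite cost (Alaoglu and lower semicontinuity), hence countably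
    additive, which contradicts [theta < I x]. *)

Require Import Defs.
From Stdlib Require Import Reals List.
From Coquelicot Require Import Coquelicot.
From Stdlib Require Import Lra Lia Classical FunctionalExtensionality.
From mathcomp Require boolp filter.
Open Scope R_scope.

(** * Bounded sequences *)

Definition sscal (a : R) (x : seqR) : seqR := fun n => a * x n.
Definition unit_seq (k : nat) : seqR := fun n => if Nat.eqb n k then 1 else 0.
(** The sets $\{m\ge n\}$, Boolean so that they fit [splice]; from Monotone continuity only the case
    of this sequence is drawn on below. *)
Definition tail_set (n m : nat) : bool := Nat.leb n m.
Definition tail (n : nat) : seqR := fun m => if tail_set n m then 1 else 0.

Ltac seq_ring :=
  apply functional_extensionality; intro;
  unfold sadd, sscal, smix, cst; try ring; try (field; lra).

Lemma linf_cst t : in_linf (cst t).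
Proof. exists (Rabs t); intro n; unfold cst; lra. Qed.

Lemma linf_sadd x y : in_linf x -> in_linf y -> in_linf (sadd x y).
Proof.
  intros [M HM] [N HN]; exists (M + N); intro n; unfold sadd.
  pose proof (Rabs_triang (x n) (y n)); specialize (HM n); specialize (HN n); lra.
Qed.

Lemma linf_sscal a x : in_linf x -> in_linf (sscal a x).
Proof.
  intros [M HM]; exists (Rabs a * M); intro n; unfold sscal.
  rewrite Rabs_mult; apply Rmult_le_compat_l; [apply Rabs_pos | apply HM].
Qed.

Lemma smix_sadd a x y : smix a x y = sadd (sscal a x) (sscal (1 - a) y).
Proof. reflexivity. Qed.

Lemma linf_smix a x y : in_linf x -> in_linf y -> in_linf (smix a x y).
Proof. intros; rewrite smix_sadd; apply linf_sadd; apply linf_sscal; assumption. Qed.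

Lemma linf_bool (f : nat -> bool) : in_linf (fun n => if f n then 1 else 0).
Proof. exists 1; intro n; destruct (f n); rewrite ?Rabs_R1, ?Rabs_R0; lra. Qed.

Lemma linf_unit k : in_linf (unit_seq k).
Proof. exact (linf_bool (fun n => Nat.eqb n k)). Qed.

Lemma linf_tail n : in_linf (tail n).
Proof. exact (linf_bool (tail_set n)). Qed.

Lemma linf_mul_tail n x : in_linf x -> in_linf (fun m => x m * tail n m).
Proof.
  intros [M HM]; exists M; intro m; specialize (HM m); unfold tail.
  pose proof (Rabs_pos (x m)); destruct (tail_set n m);
    [rewrite Rmult_1_r; lra | rewrite Rmult_0_r, Rabs_R0; lra].
Qed.

Lemma linf_splice A x y : in_linf x -> in_linf y -> in_linf (splice A x y).
Proof.
  intros [M HM] [N HN]; exists (Rmax M N); intro n; unfold splice.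
  pose proof (Rmax_l M N); pose proof (Rmax_r M N).
  specialize (HM n); specialize (HN n); destruct (A n); lra.
Qed.

(** The bound is strictly positive so that it may serve as a divisor or a scaling factor. *)
Lemma linf_bound x : in_linf x -> exists M, 0 < M /\ forall n, - M <= x n <= M.
Proof.
  intros [M HM]; exists (M + 1); split.
  - pose proof (Rabs_pos (x O)); specialize (HM O); lra.
  - intro n; specialize (HM n); apply Rabs_le_between in HM; lra.
Qed.

Create HintDb linf.
Global Hint Resolve linf_cst linf_sadd linf_sscal linf_smix linf_unit linf_tail
  linf_mul_tail linf_splice : linf.

(** * The operator $T$ and concave niveloids *)

Section Operator.
Variable T : seqR -> seqR.
Hypothesis HT : cont_pos_linear T.

Lemma T_linf x : in_linf x -> in_linf (T x).
Proof. apply HT. Qed.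
Hint Resolve T_linf : linf.

Lemma T_sadd x y : in_linf x -> in_linf y -> T (sadd x y) = sadd (T x) (T y).
Proof.
  intros Hx Hy; apply functional_extensionality; intro n.
  replace (sadd x y) with (fun k => 1 * x k + 1 * y k) by seq_ring.
  destruct HT as (_ & HL & _); rewrite HL by assumption; unfold sadd; ring.
Qed.

Lemma T_sscal a x : in_linf x -> T (sscal a x) = sscal a (T x).
Proof.
  intros Hx; apply functional_extensionality; intro n.
  replace (sscal a x) with (fun k => a * x k + 0 * x k) by seq_ring.
  destruct HT as (_ & HL & _); rewrite HL by assumption; unfold sscal; ring.
Qed.

(** These properties of the constant equivalent pass to difference quotients
    and to increasing limits, hence to directional derivatives. *)
Record niveloid (f : seqR -> R) : Prop := {
  niv_mono : forall x y, in_linf x -> in_linf y -> sge x y -> f y <= f x;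
  niv_cst : forall x t, in_linf x -> f (sadd x (cst t)) = f x + t;
  niv_0 : f (cst 0) = 0;
  niv_conc : forall x y a, in_linf x -> in_linf y -> 0 <= a <= 1 ->
    a * f x + (1 - a) * f y <= f (smix a x y);
  niv_T : forall x d, in_linf x -> in_linf d ->
    f x <= f (sadd x d) -> f x <= f (sadd x (T d)) }.

Lemma niv_const f t : niveloid f -> f (cst t) = t.
Proof.
  intro Hf; replace (cst t) with (sadd (cst 0) (cst t)) by seq_ring.
  rewrite (niv_cst f Hf), (niv_0 f Hf) by auto with linf; ring.
Qed.

Lemma niv_le f x M : niveloid f -> in_linf x -> (forall n, x n <= M) -> f x <= M.
Proof.
  intros Hf Hx HM; rewrite <- (niv_const f M Hf).
  apply (niv_mono f Hf); auto with linf.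
Qed.

(** * Directional derivatives of concave niveloids *)

Definition quotient (f : seqR -> R) (x : seqR) (t : R) (d : seqR) : R :=
  (f (sadd x (sscal t d)) - f x) / t.

Lemma Rdiv_le_r a b t : 0 < t -> a <= b -> a / t <= b / t.
Proof.
  intros Ht Hab; apply Rmult_le_compat_r; [left; apply Rinv_0_lt_compat|]; assumption.
Qed.

Lemma Rdiv_le_r_inv a b t : 0 < t -> a / t <= b / t -> a <= b.
Proof.
  intros Ht Hab; replace a with (t * (a / t)) by (field; lra).
  replace b with (t * (b / t)) by (field; lra).
  apply Rmult_le_compat_l; lra.
Qed.

(** Each property survives the substitution $d\mapsto x+td$: a translation by $s$ becomes one by
    $ts$, and the implication for $T$ is used at $x+ty$ with increment $td$, since $T(td)=tT(d)$. *)
Lemma quotient_niveloid f x t : niveloid f -> in_linf x -> 0 < t ->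
  niveloid (quotient f x t).
Proof.
  intros Hf Hx Ht; unfold quotient; split.
  - intros y z Hy Hz Hyz; apply Rdiv_le_r; [assumption|].
    cut (f (sadd x (sscal t z)) <= f (sadd x (sscal t y))); [lra|].
    apply (niv_mono f Hf); auto with linf.
    intro n; specialize (Hyz n); unfold sadd, sscal.
    apply Rplus_le_compat_l, Rmult_le_compat_l; lra.
  - intros y s Hy.
    replace (sadd x (sscal t (sadd y (cst s))))
      with (sadd (sadd x (sscal t y)) (cst (t * s))) by seq_ring.
    rewrite (niv_cst f Hf) by auto with linf; field; lra.
  - replace (sadd x (sscal t (cst 0))) with x by seq_ring.
    field; lra.
  - intros y z a Hy Hz Ha.
    replace (sadd x (sscal t (smix a y z)))
      with (smix a (sadd x (sscal t y)) (sadd x (sscal t z))) by seq_ring.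
    pose proof (niv_conc f Hf (sadd x (sscal t y)) (sadd x (sscal t z)) a) as Hc.
    match goal with |- ?l <= _ => replace l with
      ((a * f (sadd x (sscal t y)) + (1 - a) * f (sadd x (sscal t z)) - f x) / t)
      by (field; lra) end.
    apply Rdiv_le_r; [assumption|].
    cut (a * f (sadd x (sscal t y)) + (1 - a) * f (sadd x (sscal t z)) <=
      f (smix a (sadd x (sscal t y)) (sadd x (sscal t z)))); [lra|].
    apply Hc; auto with linf.
  - intros y d Hy Hd Hle.
    apply Rdiv_le_r_inv in Hle; [|assumption].
    apply Rdiv_le_r; [assumption|].
    replace (sadd x (sscal t (sadd y d)))
      with (sadd (sadd x (sscal t y)) (sscal t d)) in Hle by seq_ring.
    replace (sadd x (sscal t (sadd y (T d))))
      with (sadd (sadd x (sscal t y)) (T (sscal t d)))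
      by (rewrite T_sscal by assumption; seq_ring).
    cut (f (sadd x (sscal t y)) <= f (sadd (sadd x (sscal t y)) (T (sscal t d)))); [lra|].
    apply (niv_T f Hf); auto with linf; lra.
Qed.

(** Concavity: $x+sd$ is the mixture of $x+td$ and $x$ with weight $s/t$. *)
Lemma quotient_antitone f x d s t : niveloid f -> in_linf x -> in_linf d ->
  0 < s -> s <= t -> quotient f x t d <= quotient f x s d.
Proof.
  intros Hf Hx Hd Hs Hst; unfold quotient.
  assert (Hr : 0 <= s / t <= 1).
  { split; [apply Rlt_le, Rdiv_lt_0_compat; lra|].
    apply Rmult_le_reg_r with t; [lra|]; field_simplify; lra. }
  pose proof (niv_conc f Hf (sadd x (sscal t d)) x (s / t) ltac:(auto with linf) Hx Hr) as Hc.
  replace (smix (s / t) (sadd x (sscal t d)) x) with (sadd x (sscal s d)) in Hc by seq_ring.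
  replace ((f (sadd x (sscal t d)) - f x) / t)
    with ((s / t * f (sadd x (sscal t d)) + (1 - s / t) * f x - f x) / s)
    by (field; lra).
  apply Rdiv_le_r; lra.
Qed.

(** * Increasing limits of niveloids *)

Definition incr_lim (h : nat -> seqR -> R) (x : seqR) : R := real (Lim_seq (fun n => h n x)).

Section IncrLim.
Variable h : nat -> seqR -> R.
Hypothesis Hh : forall n, niveloid (h n).
Hypothesis Hincr : forall n x, in_linf x -> h n x <= h (S n) x.

(** An upper bound of [x] bounds all [h n x], so the limit is finite and the default value of [real]
    at infinity never occurs. *)
Lemma incr_lim_correct x : in_linf x -> is_lim_seq (fun n => h n x) (incr_lim h x).
Proof.
  intros Hx; destruct (linf_bound x Hx) as [M [_ HM]].
  apply Lim_seq_correct', ex_finite_lim_seq_incr with M.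
  - intro n; apply Hincr; assumption.
  - intro n; apply niv_le; auto; apply HM.
Qed.

Lemma incr_lim_ge n x : in_linf x -> h n x <= incr_lim h x.
Proof.
  intros Hx; apply (is_lim_seq_incr_compare (fun n => h n x)).
  - apply incr_lim_correct; assumption.
  - intro k; apply Hincr; assumption.
Qed.

Lemma incr_lim_le x b : in_linf x -> (forall n, h n x <= b) -> incr_lim h x <= b.
Proof.
  intros Hx Hb.
  exact (is_lim_seq_le (fun n => h n x) (fun _ => b) _ b Hb
    (incr_lim_correct x Hx) (is_lim_seq_const b)).
Qed.

Lemma incr_lim_near x b : in_linf x -> b < incr_lim h x -> exists n, b < h n x.
Proof.
  intros Hx Hb; apply NNPP; intro H.
  apply (Rlt_not_le _ _ Hb), incr_lim_le; [assumption|].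
  intro n; apply Rnot_lt_le; intro; apply H; exists n; assumption.
Qed.

Lemma incr_lim_monotone n m x : in_linf x -> (n <= m)%nat -> h n x <= h m x.
Proof.
  intros Hx Hnm; induction Hnm; [lra|].
  apply Rle_trans with (1 := IHHnm), Hincr; assumption.
Qed.

(** A strict inequality between limits is already visible at a finite stage: from some [n] on,
    $h_k(x+d)$ exceeds the limit at [x], hence $h_k(x)$, and the implication for $h_k$ applies. *)
Lemma incr_lim_T_strict x d : in_linf x -> in_linf d ->
  incr_lim h x < incr_lim h (sadd x d) -> incr_lim h x <= incr_lim h (sadd x (T d)).
Proof.
  intros Hx Hd Hlt.
  destruct (incr_lim_near _ _ (linf_sadd _ _ Hx Hd) Hlt) as [n Hn].
  apply incr_lim_le; [assumption|]; intro m.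
  set (k := Nat.max n m).
  apply Rle_trans with (h k x); [apply incr_lim_monotone; [assumption|lia]|].
  apply Rle_trans with (h k (sadd x (T d))); [|apply incr_lim_ge; auto with linf].
  apply (niv_T _ (Hh k)); auto.
  apply Rle_trans with (incr_lim h x); [apply incr_lim_ge; assumption|].
  apply Rle_trans with (h n (sadd x d)); [lra|].
  apply incr_lim_monotone; [auto with linf|lia].
Qed.

Lemma incr_lim_niveloid : niveloid (incr_lim h).
Proof.
  assert (Hmono : forall x y, in_linf x -> in_linf y -> sge x y ->
    incr_lim h y <= incr_lim h x).
  { intros x y Hx Hy Hxy; apply incr_lim_le; [assumption|]; intro n.
    apply Rle_trans with (h n x); [apply (niv_mono _ (Hh n)); assumption|].
    apply incr_lim_ge; assumption. }
  assert (Hcst : forall x t, in_linf x -> incr_lim h (sadd x (cst t)) = incr_lim h x + t).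
  { intros x t Hx.
    assert (Heq : forall n, h n (sadd x (cst t)) = h n x + t)
      by (intro n; apply (niv_cst _ (Hh n)); assumption).
    apply Rle_antisym.
    - apply incr_lim_le; [auto with linf|]; intro n; rewrite Heq.
      pose proof (incr_lim_ge n x Hx); lra.
    - cut (incr_lim h x <= incr_lim h (sadd x (cst t)) - t); [lra|].
      apply incr_lim_le; [assumption|]; intro n.
      pose proof (incr_lim_ge n (sadd x (cst t)) ltac:(auto with linf)) as Hn.
      rewrite Heq in Hn; lra. }
  split; try assumption.
  - apply Rle_antisym.
    + apply incr_lim_le; [auto with linf|]; intro n; rewrite (niv_0 _ (Hh n)); lra.
    + pose proof (incr_lim_ge O (cst 0) (linf_cst 0)) as H.
      rewrite (niv_0 _ (Hh O)) in H; exact H.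
  - intros x y a Hx Hy Ha.
    assert (Hl : is_lim_seq (fun n => a * h n x + (1 - a) * h n y)
      (a * incr_lim h x + (1 - a) * incr_lim h y)).
    { apply is_lim_seq_plus'; apply is_lim_seq_mult';
        try apply is_lim_seq_const; apply incr_lim_correct; assumption. }
    refine (is_lim_seq_le _ (fun n => h n (smix a x y)) _ _ _ Hl
      (incr_lim_correct _ (linf_smix a x y Hx Hy))).
    intro n; apply (niv_conc _ (Hh n)); assumption.
  - intros x d Hx Hd Hle.
    destruct (linf_bound (T (cst 1)) ltac:(auto with linf)) as [C [HC0 HC]].
    apply le_epsilon; intros eps Heps.
    (* A weak inequality need not hold at any finite stage. Replacing [d] by [d + e] makes it
       strict, and $T(e)\le eC=\varepsilon$ bounds the price. *)
    set (e := eps / C).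
    assert (He : 0 < e) by (apply Rdiv_lt_0_compat; assumption).
    assert (Hs : incr_lim h x < incr_lim h (sadd x (sadd d (cst e)))).
    { replace (sadd x (sadd d (cst e))) with (sadd (sadd x d) (cst e)) by seq_ring.
      rewrite Hcst by auto with linf; lra. }
    apply incr_lim_T_strict in Hs; auto with linf.
    apply Rle_trans with (1 := Hs).
    rewrite <- Hcst by auto with linf.
    apply Hmono; auto with linf.
    intro n; rewrite T_sadd by auto with linf.
    replace (cst e) with (sscal e (cst 1)) by seq_ring.
    rewrite T_sscal by auto with linf.
    replace eps with (e * C) by (unfold e; field; lra).
    pose proof (Rmult_le_compat_l e (T (cst 1) n) C (Rlt_le _ _ He) (proj2 (HC n))).
    unfold sadd, sscal; change (cst (e * C) n) with (e * C); lra.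
Qed.
End IncrLim.

(** * One-sided directional derivatives *)

Definition step (n : nat) : R := / INR (S n).

Lemma step_pos n : 0 < step n.
Proof. apply Rinv_0_lt_compat, lt_0_INR; lia. Qed.

Lemma step_decr n : step (S n) <= step n.
Proof.
  apply Rinv_le_contravar; [apply lt_0_INR; lia|apply le_INR; lia].
Qed.

Lemma step_small t : 0 < t -> exists n, step n <= t.
Proof.
  intro Ht; destruct (archimed_cor1 t Ht) as [n [Hn Hpos]].
  exists (pred n); unfold step; replace (S (pred n)) with n by lia; lra.
Qed.

(** Quotients grow as the step shrinks, so the limit along the steps $1/(n+1)$ is also the supremum
    over all positive steps. *)
Definition derivative (f : seqR -> R) (x : seqR) : seqR -> R :=
  incr_lim (fun n => quotient f x (step n)).

Section Derivative.
Variables (f : seqR -> R) (x : seqR).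
Hypotheses (Hf : niveloid f) (Hx : in_linf x).

Let Hq n : niveloid (quotient f x (step n)).
Proof. apply quotient_niveloid; auto using step_pos. Qed.

Let Hqi n d : in_linf d -> quotient f x (step n) d <= quotient f x (step (S n)) d.
Proof. intro; apply quotient_antitone; auto using step_pos, step_decr. Qed.

Lemma derivative_niveloid : niveloid (derivative f x).
Proof. apply incr_lim_niveloid; [exact Hq | exact Hqi]. Qed.

Lemma quotient_le_derivative t d : in_linf d -> 0 < t -> quotient f x t d <= derivative f x d.
Proof.
  intros Hd Ht; destruct (step_small t Ht) as [n Hn].
  apply Rle_trans with (quotient f x (step n) d).
  - apply quotient_antitone; auto using step_pos.
  - apply (incr_lim_ge _ Hq Hqi n); assumption.
Qed.

Lemma increment_le_derivative d : in_linf d -> f (sadd x d) <= f x + derivative f x d.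
Proof.
  intro Hd; pose proof (quotient_le_derivative 1 d Hd Rlt_0_1) as H.
  unfold quotient in H; replace (sscal 1 d) with d in H by seq_ring; lra.
Qed.

(** The quotient with step $t$ in direction $sd$ is $s$ times the one with step $st$ in direction
    $d$. *)
Lemma derivative_homog_le s d : in_linf d -> 0 < s ->
  derivative f x (sscal s d) <= s * derivative f x d.
Proof.
  intros Hd Hs; apply (incr_lim_le _ Hq Hqi); [auto with linf|]; intro n.
  pose proof (step_pos n).
  replace (quotient f x (step n) (sscal s d)) with (s * quotient f x (s * step n) d).
  - apply Rmult_le_compat_l; [lra|].
    apply quotient_le_derivative; [assumption|]; apply Rmult_lt_0_compat; assumption.
  - unfold quotient.
    replace (sscal (step n) (sscal s d)) with (sscal (s * step n) d) by seq_ring.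
    field; split; lra.
Qed.
End Derivative.

(** * Superlinear functionals and additivity along a direction *)

Definition superlinear (g : seqR -> R) : Prop :=
  niveloid g /\ forall s d, in_linf d -> 0 < s -> g (sscal s d) = s * g d.

Lemma derivative_superlinear f x : niveloid f -> in_linf x -> superlinear (derivative f x).
Proof.
  intros Hf Hx; split; [apply derivative_niveloid; assumption|].
  intros s d Hd Hs; apply Rle_antisym; [apply derivative_homog_le; assumption|].
  (* The reverse inequality is the same bound with factor $1/s$ in direction $sd$. *)
  pose proof (derivative_homog_le f x Hf Hx (/ s) (sscal s d) ltac:(auto with linf)
    (Rinv_0_lt_compat _ Hs)) as H.
  replace (sscal (/ s) (sscal s d)) with d in H by seq_ring.
  apply Rmult_le_compat_l with (r := s) in H; [|lra].
  rewrite <- Rmult_assoc, Rinv_r, Rmult_1_l in H by lra; exact H.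
Qed.

Lemma superlinear_add g x y : superlinear g -> in_linf x -> in_linf y ->
  g x + g y <= g (sadd x y).
Proof.
  intros [Hn Hs] Hx Hy.
  replace (sadd x y) with (sscal 2 (smix (1/2) x y)) by seq_ring.
  rewrite Hs by (auto with linf; lra).
  pose proof (niv_conc g Hn x y (1/2) Hx Hy ltac:(lra)); lra.
Qed.

(** By superadditivity $g(d)\le g(e+d)-g(e)$, and the derivative dominates this increment. *)
Lemma superlinear_le_derivative g e d : superlinear g -> in_linf e -> in_linf d ->
  g d <= derivative g e d.
Proof.
  intros Hg He Hd.
  pose proof (superlinear_add g e d Hg He Hd).
  pose proof (increment_le_derivative g e (proj1 Hg) He d Hd); lra.
Qed.

Lemma superlinear_opp_le g e : superlinear g -> in_linf e -> g e + g (sscal (-1) e) <= 0.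
Proof.
  intros Hg He; pose proof (superlinear_add g e (sscal (-1) e) Hg He ltac:(auto with linf)) as H.
  replace (sadd e (sscal (-1) e)) with (cst 0) in H by seq_ring.
  rewrite (niv_0 g (proj1 Hg)) in H; exact H.
Qed.

(** The derivative at [e] is at least $g(e)$ in direction $e$ and at least $g(0)-g(e)=-g(e)$ in
    direction $-e$. *)
Lemma derivative_self_linear g e : superlinear g -> in_linf e ->
  0 <= derivative g e e + derivative g e (sscal (-1) e).
Proof.
  intros Hg He.
  pose proof (superlinear_le_derivative g e e Hg He He) as H1.
  pose proof (increment_le_derivative g e (proj1 Hg) He (sscal (-1) e) ltac:(auto with linf)) as H2.
  replace (sadd e (sscal (-1) e)) with (cst 0) in H2 by seq_ring.
  rewrite (niv_0 g (proj1 Hg)) in H2; lra.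
Qed.

(** The hypothesis forces $g(-e)=-g(e)$, so [g] is linear on the line through [e]. Superadditivity
    for $x$ and $se$, then for $x+se$ and $-se$, gives the two inequalities. *)
Lemma superlinear_additive g e : superlinear g -> in_linf e ->
  0 <= g e + g (sscal (-1) e) ->
  forall x s, in_linf x -> g (sadd x (sscal s e)) = g x + s * g e.
Proof.
  intros Hg He Hopp.
  assert (Hs : forall s, g (sscal s e) = s * g e).
  { pose proof (superlinear_opp_le g e Hg He) as Hle.
    intro s; destruct (Rtotal_order s 0) as [H | [H | H]].
    - replace (sscal s e) with (sscal (- s) (sscal (-1) e)) by seq_ring.
      rewrite (proj2 Hg) by (auto with linf; lra).
      replace (g (sscal (-1) e)) with (- g e) by lra; ring.
    - subst s; replace (sscal 0 e) with (cst 0) by seq_ring.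
      rewrite (niv_0 g (proj1 Hg)); ring.
    - apply (proj2 Hg); assumption. }
  assert (Hge : forall x s, in_linf x -> g x + s * g e <= g (sadd x (sscal s e))).
  { intros x s Hx; rewrite <- Hs; apply superlinear_add; auto with linf. }
  intros x s Hx; apply Rle_antisym; [|apply Hge; assumption].
  pose proof (Hge (sadd x (sscal s e)) (- s) ltac:(auto with linf)) as H.
  replace (sadd (sadd x (sscal s e)) (sscal (- s) e)) with x in H by seq_ring.
  lra.
Qed.

(** * Successive differentiation at the unit sequences *)

Fixpoint iter_derivative (g : seqR -> R) (n : nat) : seqR -> R :=
  match n with
  | O => g
  | S k => derivative (iter_derivative g k) (unit_seq k)
  end.

Section IterDerivative.
Variable g : seqR -> R.
Hypothesis Hg : superlinear g.

Lemma iter_derivative_superlinear n : superlinear (iter_derivative g n).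
Proof.
  induction n; [exact Hg|]; apply derivative_superlinear; [apply IHn | apply linf_unit].
Qed.

Let Hin n : niveloid (iter_derivative g n) := proj1 (iter_derivative_superlinear n).

Let Hii n x : in_linf x -> iter_derivative g n x <= iter_derivative g (S n) x.
Proof.
  intro; apply superlinear_le_derivative; auto using iter_derivative_superlinear, linf_unit.
Qed.

Definition limit_derivative : seqR -> R := incr_lim (iter_derivative g).

Lemma limit_derivative_ge x : in_linf x -> g x <= limit_derivative x.
Proof. apply (incr_lim_ge _ Hin Hii O). Qed.

Lemma limit_derivative_superlinear : superlinear limit_derivative.
Proof.
  split; [apply incr_lim_niveloid; [exact Hin | exact Hii]|].
  intros s d Hd Hs; unfold limit_derivative, incr_lim.
  rewrite (Lim_seq_ext _ (fun n => s * iter_derivative g n d)).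
  - rewrite Lim_seq_scal_l.
    rewrite (is_lim_seq_unique _ _ (incr_lim_correct _ Hin Hii d Hd)); reflexivity.
  - intro n; apply (proj2 (iter_derivative_superlinear n)); assumption.
Qed.

(** The criterion $0\le g(e_k)+g(-e_k)$ holds after the differentiation at $e_k$, that is at stage
    [S k], and persists because the limit lies above that stage. *)
Lemma limit_derivative_additive k x s : in_linf x ->
  limit_derivative (sadd x (sscal s (unit_seq k))) =
  limit_derivative x + s * limit_derivative (unit_seq k).
Proof.
  apply superlinear_additive; [apply limit_derivative_superlinear | apply linf_unit |].
  pose proof (derivative_self_linear _ _ (iter_derivative_superlinear k) (linf_unit k)).
  pose proof (incr_lim_ge _ Hin Hii (S k) (unit_seq k) (linf_unit k)).
  pose proof (incr_lim_ge _ Hin Hii (S k) (sscal (-1) (unit_seq k)) ltac:(auto with linf)).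
  unfold limit_derivative; simpl iter_derivative in *; lra.
Qed.
End IterDerivative.

(** * The functionals of Fbar *)

(** The elements of $\Delta$, seen as positive normalized linear functionals on $l_\infty$. *)
Record state (phi : seqR -> R) : Prop := {
  st_lin : forall x y a b, in_linf x -> in_linf y ->
    phi (fun k => a * x k + b * y k) = a * phi x + b * phi y;
  st_pos : forall x, in_linf x -> sge x (cst 0) -> 0 <= phi x;
  st_1 : phi (cst 1) = 1 }.

Section State.
Variable phi : seqR -> R.
Hypothesis Hphi : state phi.

Lemma state_sadd x y : in_linf x -> in_linf y -> phi (sadd x y) = phi x + phi y.
Proof.
  intros Hx Hy; replace (sadd x y) with (fun k => 1 * x k + 1 * y k) by seq_ring.
  rewrite (st_lin _ Hphi) by assumption; ring.
Qed.

Lemma state_sscal a x : in_linf x -> phi (sscal a x) = a * phi x.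
Proof.
  intros Hx; replace (sscal a x) with (fun k => a * x k + 0 * x k) by seq_ring.
  rewrite (st_lin _ Hphi) by assumption; ring.
Qed.

Lemma state_cst t : phi (cst t) = t.
Proof.
  replace (cst t) with (sscal t (cst 1)) by seq_ring.
  rewrite state_sscal, (st_1 _ Hphi) by auto with linf; ring.
Qed.

Lemma state_mono x y : in_linf x -> in_linf y -> sge x y -> phi y <= phi x.
Proof.
  intros Hx Hy Hxy; replace x with (sadd y (sadd x (sscal (-1) y))) by seq_ring.
  rewrite state_sadd by auto with linf.
  cut (0 <= phi (sadd x (sscal (-1) y))); [lra|].
  apply (st_pos _ Hphi); auto with linf.
  intro n; specialize (Hxy n); unfold sadd, sscal, cst; lra.
Qed.

Lemma state_bound x M : in_linf x -> (forall n, Rabs (x n) <= M) -> Rabs (phi x) <= M.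
Proof.
  intros Hx HM; apply Rabs_le; rewrite <- (state_cst (- M)); rewrite <- (state_cst M) at 2.
  split; apply state_mono; auto with linf;
    intro n; specialize (HM n); apply Rabs_le_between in HM; unfold cst; lra.
Qed.

Lemma state_in_ba : in_ba phi.
Proof.
  split; [apply (st_lin _ Hphi)|].
  exists 1; intros x M Hx HM; rewrite Rmult_1_l; apply state_bound; assumption.
Qed.
End State.

Lemma ex_series_pair x p : in_Delta_sigma p -> in_linf x -> ex_series (fun n => p n * x n).
Proof.
  intros [Hp Hs] [M HM].
  apply ex_series_Rabs.
  apply (ex_series_le (V := R_CompleteNormedModule) _ (fun n => M * p n)).
  - intro n; unfold norm; simpl; unfold abs; simpl.
    rewrite Rabs_Rabsolu, Rabs_mult, (Rabs_pos_eq (p n)), Rmult_comm by apply Hp.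
    apply Rmult_le_compat_r; [apply Hp | apply HM].
  - apply (ex_series_scal_l M p); exists 1; exact Hs.
Qed.

Lemma pair_state p : in_Delta_sigma p -> state (fun x => pair x p).
Proof.
  intros Hp; split.
  - intros x y a b Hx Hy; unfold pair.
    rewrite <- !Series_scal_l, <- Series_plus.
    + apply Series_ext; intro n; ring.
    + apply (ex_series_scal_l a (fun n => p n * x n)), ex_series_pair; assumption.
    + apply (ex_series_scal_l b (fun n => p n * y n)), ex_series_pair; assumption.
  - intros x Hx Hx0; unfold pair.
    replace 0 with (Series (fun n => 0 * (p n * x n))) by (rewrite Series_scal_l; ring).
    apply Series_le; [|apply ex_series_pair; assumption].
    intro n; specialize (Hx0 n); unfold cst in Hx0.
    pose proof (Rmult_le_pos _ _ (proj1 Hp n) Hx0); lra.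
  - unfold pair, cst; rewrite (Series_ext _ p) by (intro; ring).
    apply is_series_unique, Hp.
Qed.

(** Testing at the constant $1$ identifies the eigenvalue as $\langle T(1),p\rangle$, an expression
    that is weak$^\star$ continuous in [p]. *)
Lemma inF_eigenvalue p x : inF T p -> in_linf x -> pair (T x) p = pair (T (cst 1)) p * pair x p.
Proof.
  intros [Hp [l Hl]] Hx; rewrite !Hl by auto with linf.
  rewrite (state_cst _ (pair_state p Hp)); ring.
Qed.

Lemma inF_in_Fbar p : inF T p -> in_Fbar T (fun x => pair x p).
Proof.
  intros Hp; split; [apply state_in_ba, pair_state, Hp|].
  intros xs eps _ Heps; exists p; split; [assumption|].
  intros x _; rewrite Rminus_diag, Rabs_R0; assumption.
Qed.

Lemma Fbar_approx phi xs eps : in_Fbar T phi -> List.Forall in_linf xs -> 0 < eps ->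
  exists p, inF T p /\ forall x, In x xs -> phi x - eps < pair x p < phi x + eps.
Proof.
  intros [_ Hphi] Hxs Heps; destruct (Hphi xs eps Hxs Heps) as [p [Hp Hn]].
  exists p; split; [assumption|].
  intros x Hx; specialize (Hn x Hx); simpl in Hn; apply Rabs_lt_between in Hn; lra.
Qed.

Lemma Fbar_approx1 phi x eps : in_Fbar T phi -> in_linf x -> 0 < eps ->
  exists p, inF T p /\ phi x - eps < pair x p < phi x + eps.
Proof.
  intros Hphi Hx Heps.
  destruct (Fbar_approx phi (x :: nil) eps Hphi ltac:(repeat constructor; assumption) Heps)
    as [p [Hp Hn]].
  exists p; split; [assumption|]; apply Hn; left; reflexivity.
Qed.

(** Positivity and normalization are weak$^\star$ closed conditions. *)
Lemma Fbar_state phi : in_Fbar T phi -> state phi.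
Proof.
  intros Hphi; split; [apply Hphi| |].
  - intros x Hx Hx0; apply le_epsilon; intros eps Heps.
    destruct (Fbar_approx1 phi x eps Hphi Hx Heps) as [p [Hp Hn]].
    pose proof (st_pos _ (pair_state p (proj1 Hp)) x Hx Hx0); simpl in *; lra.
  - apply cond_eq; intros eps Heps.
    destruct (Fbar_approx1 phi (cst 1) eps Hphi (linf_cst 1) Heps) as [p [Hp Hn]].
    pose proof (st_1 _ (pair_state p (proj1 Hp))) as H1; simpl in H1.
    apply Rabs_lt_between; lra.
Qed.

(** The eigenvector equation passes to the closure: on $y=T(x)-lx$ an approximating [p] takes the
    value $(\langle T(1),p\rangle-l)\langle x,p\rangle$, small because [x] is bounded. *)
Lemma Fbar_eigenvalue phi x : in_Fbar T phi -> in_linf x -> phi (T x) = phi (T (cst 1)) * phi x.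
Proof.
  intros Hphi Hx; pose proof (Fbar_state phi Hphi) as Hst.
  destruct (linf_bound x Hx) as [M [HM0 HM]].
  set (l := phi (T (cst 1))).
  set (y := sadd (T x) (sscal (- l) x)).
  assert (Hy : in_linf y) by (unfold y; auto with linf).
  cut (phi y = 0).
  { unfold y; rewrite (state_sadd _ Hst), (state_sscal _ Hst) by auto with linf; lra. }
  apply cond_eq; intros eps Heps; rewrite Rminus_0_r.
  (* The approximation at [y] costs [e] and the deviation of the eigenvalue costs [e * M]. *)
  set (e := eps / (M + 1)).
  assert (He : 0 < e) by (apply Rdiv_lt_0_compat; lra).
  destruct (Fbar_approx phi (y :: T (cst 1) :: nil) e Hphi
    ltac:(repeat constructor; auto with linf) He) as [p [Hp Hn]].
  pose proof (Hn y (or_introl eq_refl)) as Hny.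
  pose proof (Hn (T (cst 1)) (or_intror (or_introl eq_refl))) as Hn1; fold l in Hn1.
  pose proof (pair_state p (proj1 Hp)) as Hps.
  assert (Hpy : pair y p = (pair (T (cst 1)) p - l) * pair x p).
  { unfold y; rewrite (state_sadd _ Hps), (state_sscal _ Hps) by auto with linf.
    rewrite (inF_eigenvalue p x Hp Hx); ring. }
  assert (Hb : Rabs (pair y p) <= e * M).
  { rewrite Hpy, Rabs_mult; apply Rmult_le_compat; try apply Rabs_pos.
    - apply Rabs_le; lra.
    - apply (state_bound _ Hps); [assumption|]; intro n; apply Rabs_le, HM. }
  apply Rabs_le_between in Hb.
  replace eps with (e * M + e) by (unfold e; field; lra).
  apply Rabs_lt_between; lra.
Qed.

(** This makes the criterion for countable additivity below applicable to elements of $\overline F$.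
    The implication for $T$ holds as $\varphi(T(d))$ is $\varphi(d)$ times a nonnegative
    eigenvalue. *)
Lemma Fbar_superlinear phi : in_Fbar T phi -> superlinear phi.
Proof.
  intros Hphi; pose proof (Fbar_state phi Hphi) as Hst.
  split; [|intros; apply state_sscal; assumption].
  split.
  - apply state_mono; assumption.
  - intros; rewrite (state_sadd _ Hst), (state_cst _ Hst) by auto with linf; reflexivity.
  - apply state_cst; assumption.
  - intros; rewrite smix_sadd, (state_sadd _ Hst), !(state_sscal _ Hst) by auto with linf; lra.
  - intros x d Hx Hd; rewrite !(state_sadd _ Hst), Fbar_eigenvalue by auto with linf; intro H.
    cut (0 <= phi (T (cst 1)) * phi d); [lra|].
    apply Rmult_le_pos; [|lra].
    apply (st_pos _ Hst); auto with linf.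
    destruct HT as (_ & _ & HP & _); apply HP; auto with linf.
    intro n; unfold cst; lra.
Qed.

(** * Countable additivity from additivity along unit sequences and vanishing tails *)

Section CountablyAdditive.
Variable g : seqR -> R.
Hypothesis Hg : superlinear g.
Hypothesis Hadd : forall k x s, in_linf x ->
  g (sadd x (sscal s (unit_seq k))) = g x + s * g (unit_seq k).
Hypothesis Htight : forall eps, 0 < eps -> exists n, - eps <= g (sscal (-1) (tail n)).

Let p : seqR := fun k => g (unit_seq k).

Lemma mul_tail_split x n : (fun m => x m * tail n m) =
  sadd (fun m => x m * tail (S n) m) (sscal (x n) (unit_seq n)).
Proof.
  apply functional_extensionality; intro m; unfold sadd, sscal, unit_seq, tail, tail_set.
  destruct (Nat.eqb_spec m n) as [-> | Hne].
  - rewrite (proj2 (Nat.leb_le n n)), (proj2 (Nat.leb_gt (S n) n)) by lia; ring.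
  - destruct (Nat.leb_spec n m).
    + rewrite (proj2 (Nat.leb_le (S n) m)) by lia; ring.
    + rewrite (proj2 (Nat.leb_gt (S n) m)) by lia; ring.
Qed.

(** Coordinates are split off one at a time by [Hadd], starting from [tail 0], which is the constant
    $1$. *)
Lemma head_tail x n : in_linf x ->
  g x = sum_n (fun k => p k * x k) n + g (fun m => x m * tail (S n) m).
Proof.
  intro Hx.
  assert (Hstep : forall n, g (fun m => x m * tail n m) =
    g (fun m => x m * tail (S n) m) + x n * p n).
  { intro k; rewrite (mul_tail_split x k); apply Hadd; auto with linf. }
  induction n.
  - rewrite sum_O.
    transitivity (g (fun m => x m * tail 0 m)).
    + f_equal; apply functional_extensionality; intro m; unfold tail, tail_set; simpl; ring.
    + rewrite Hstep; ring.
  - rewrite sum_Sn, IHn, (Hstep (S n)); unfold plus; simpl; ring.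
Qed.

(** Beyond [N] the value lies between $Mg(-\mathrm{tail}_N)\ge-\varepsilon/2$ and
    $Mg(\mathrm{tail}_N)$, which superadditivity bounds by
    $-Mg(-\mathrm{tail}_N)\le\varepsilon/2$. *)
Lemma mul_tail_small x : in_linf x -> is_lim_seq (fun n => g (fun m => x m * tail n m)) 0.
Proof.
  intro Hx; destruct (linf_bound x Hx) as [M [HM0 HM]].
  apply is_lim_seq_spec; intros [eps Heps]; simpl.
  assert (He : 0 < eps / (2 * M)) by (apply Rdiv_lt_0_compat; lra).
  destruct (Htight _ He) as [N HN]; exists N; intros n Hn.
  pose proof (superlinear_opp_le g (tail N) Hg (linf_tail N)) as Hopp.
  assert (Htl : forall m, 0 <= tail n m <= tail N m).
  { intro m; unfold tail, tail_set; destruct (Nat.leb_spec n m); destruct (Nat.leb_spec N m);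
      try lia; lra. }
  assert (Hlo : g (sscal M (sscal (-1) (tail N))) <= g (fun m => x m * tail n m)).
  { apply (niv_mono g (proj1 Hg)); auto with linf.
    intro m; unfold sscal; specialize (Htl m); specialize (HM m); nra. }
  assert (Hup : g (fun m => x m * tail n m) <= g (sscal M (tail N))).
  { apply (niv_mono g (proj1 Hg)); auto with linf.
    intro m; unfold sscal; specialize (Htl m); specialize (HM m); nra. }
  rewrite (proj2 Hg) in Hlo, Hup by auto with linf.
  assert (HMe : M * - (eps / (2 * M)) = - (eps / 2)) by (field; lra).
  pose proof (Rmult_le_compat_l M _ _ (Rlt_le _ _ HM0) HN).
  assert (M * (g (tail N) + g (sscal (-1) (tail N))) <= 0) by nra.
  apply Rabs_lt_between; lra.
Qed.

Lemma countably_additive :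
  exists q, in_Delta_sigma q /\ forall x, in_linf x -> g x = pair x q.
Proof.
  (* Partial sums differ from $g(x)$ by a vanishing tail value; at the constant $1$ this gives total
     mass $1$. *)
  assert (Hser : forall x, in_linf x -> is_series (fun k => p k * x k) (g x)).
  { intros x Hx.
    change (is_lim_seq (sum_n (fun k => p k * x k)) (g x)).
    apply is_lim_seq_ext with (fun n => g x - g (fun m => x m * tail (S n) m)).
    - intro n; rewrite (head_tail x n Hx); ring.
    - replace (Finite (g x)) with (Finite (g x - 0)) by (f_equal; ring).
      apply is_lim_seq_minus'; [apply is_lim_seq_const|].
      apply (is_lim_seq_incr_1 (fun n => g (fun m => x m * tail n m))), mul_tail_small.
      assumption. }
  exists p; split; [split|].
  - intro k; unfold p; rewrite <- (niv_0 g (proj1 Hg)).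
    apply (niv_mono g (proj1 Hg)); auto with linf.
    intro m; unfold cst, unit_seq; destruct (Nat.eqb m k); lra.
  - rewrite <- (niv_const g 1 (proj1 Hg)).
    apply is_series_ext with (fun k => p k * cst 1 k); [intro; unfold cst; apply Rmult_1_r|].
    apply Hser; auto with linf.
  - intros x Hx; symmetry; apply is_series_unique, Hser; assumption.
Qed.
End CountablyAdditive.

(** * Countably additive supergradients *)

Lemma supergradient f x : niveloid f -> in_linf x ->
  (forall K, 0 < K -> exists n, f x - 1 <= f (sadd x (sscal (- K) (tail n)))) ->
  exists p, inF T p /\ forall y, in_linf y -> f y - pair y p <= f x - pair x p.
Proof.
  intros Hf Hx Htight.
  set (g := derivative f x).
  assert (Hg : superlinear g) by (apply derivative_superlinear; assumption).
  set (G := limit_derivative g).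
  assert (HG : superlinear G) by (apply limit_derivative_superlinear; assumption).
  destruct (countably_additive G HG) as [p [Hp HGp]].
  - intros; apply limit_derivative_additive; assumption.
  (* For $K=1/\varepsilon$ the quotient with step $K$ in direction $-\mathrm{tail}_n$ is at least
     $-1/K=-\varepsilon$; the derivative, and then [G], lie above it. *)
  - intros eps Heps; destruct (Htight (/ eps) (Rinv_0_lt_compat _ Heps)) as [n Hn].
    exists n.
    apply Rle_trans with (g (sscal (-1) (tail n))); [|apply limit_derivative_ge; auto with linf].
    apply Rle_trans with (quotient f x (/ eps) (sscal (-1) (tail n))).
    + unfold quotient.
      replace (sscal (/ eps) (sscal (-1) (tail n))) with (sscal (- / eps) (tail n)) by seq_ring.
      replace (- eps) with (-1 / / eps) by (field; lra).
      apply Rdiv_le_r; [apply Rinv_0_lt_compat; assumption | lra].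
    + apply quotient_le_derivative; auto with linf; apply Rinv_0_lt_compat; assumption.
  - pose proof (pair_state p Hp) as Hps.
    exists p; split; [split; [assumption|]|].
    + assert (Hpos : forall d, in_linf d -> 0 <= pair d p -> 0 <= pair (T d) p).
      { intros d Hd; pose proof (niv_T G (proj1 HG) (cst 0) d ltac:(auto with linf) Hd) as H.
        rewrite !HGp, !(state_sadd _ Hps), !(state_cst _ Hps) in H by auto with linf; lra. }
      exists (pair (T (cst 1)) p); intros y Hy.
      assert (HL : forall a b, pair (T (sadd (sscal a y) (cst b))) p =
        a * pair (T y) p + b * pair (T (cst 1)) p).
      { intros a b; replace (cst b) with (sscal b (cst 1)) by seq_ring.
        rewrite T_sadd, !T_sscal, (state_sadd _ Hps), !(state_sscal _ Hps) by auto with linf.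
        reflexivity. }
      (* [Hpos] is applied to multiples of $y-\langle y,p\rangle$, which pairs to zero with [p]; the
         factors $1$ and $-1$ together give the eigenvector equation. *)
      assert (HH : forall a, 0 <= a * pair (T y) p + - a * pair y p * pair (T (cst 1)) p).
      { intro a; rewrite <- HL; apply Hpos; auto with linf.
        rewrite (state_sadd _ Hps), (state_sscal _ Hps), (state_cst _ Hps) by auto with linf; lra. }
      pose proof (HH 1); pose proof (HH (-1)); lra.
    + intros y Hy.
      pose proof (increment_le_derivative f x Hf Hx (sadd y (sscal (-1) x)) ltac:(auto with linf)) as H1.
      pose proof (limit_derivative_ge g Hg (sadd y (sscal (-1) x)) ltac:(auto with linf)) as H2.
      fold g in H1; fold G in H2.
      replace (sadd x (sadd y (sscal (-1) x))) with y in H1 by seq_ring.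
      rewrite HGp, (state_sadd _ Hps), (state_sscal _ Hps) in H2 by auto with linf; lra.
Qed.

(** * The variational representation of a tight niveloid *)

(** What Monotone continuity amounts to for niveloids. A fixed loss of $1$ suffices: [K] is
    arbitrary, so dividing by it makes the loss small. *)
Definition tight (f : seqR -> R) : Prop := forall x K, in_linf x -> 0 < K ->
  exists n, f x - 1 <= f (sadd x (sscal (- K) (tail n))).

(** The smallest cost compatible with $f\le\varphi+c(\varphi)$, taken in [Rbar] since it may be
    infinite. *)
Definition conjugate (f : seqR -> R) (phi : seqR -> R) : Rbar :=
  Lub_Rbar (fun r => exists y, in_linf y /\ r = f y - phi y).

Section Representation.
Variable f : seqR -> R.
Hypotheses (Hf : niveloid f) (Htight : tight f).

Lemma conjugate_ge phi y : in_linf y -> Rbar_le (f y - phi y) (conjugate f phi).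
Proof.
  intro Hy; apply (proj1 (Lub_Rbar_correct _)); exists y; split; [assumption | reflexivity].
Qed.

Lemma conjugate_lt phi (t : R) : Rbar_lt t (conjugate f phi) ->
  exists y, in_linf y /\ t < f y - phi y.
Proof.
  intro Ht; apply NNPP; intro H; apply (Rbar_lt_not_le _ _ Ht).
  apply (proj2 (Lub_Rbar_correct _)); intros r [y [Hy ->]]; simpl.
  apply Rnot_lt_le; intro; apply H; exists y; split; assumption.
Qed.

Lemma conjugate_nonneg phi : in_Fbar T phi -> Rbar_le 0 (conjugate f phi).
Proof.
  intro Hphi; pose proof (conjugate_ge phi (cst 0) (linf_cst 0)) as H.
  rewrite (niv_0 f Hf), (state_cst _ (Fbar_state phi Hphi)), Rminus_0_r in H; exact H.
Qed.

Lemma conjugate_attained x : in_linf x ->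
  exists p, inF T p /\ conjugate f (fun y => pair y p) = f x - pair x p.
Proof.
  intro Hx; destruct (supergradient f x Hf Hx) as [p [Hp Hsup]]; [intros; apply Htight; assumption|].
  exists p; split; [assumption|].
  apply Rbar_le_antisym; [|exact (conjugate_ge (fun y => pair y p) x Hx)].
  apply (proj2 (Lub_Rbar_correct _)); intros r [y [Hy ->]]; apply Hsup; assumption.
Qed.

(** Evaluating the supremum at $-K\,\mathrm{tail}_n$, where $f\ge-1$, gives
    $K\varphi(\mathrm{tail}_n)\le1+C$. With $K=(1+C)/\varepsilon$ the tails vanish, so $\varphi$ is
    countably additive. *)
Lemma conjugate_finite_in_F phi C : in_Fbar T phi -> conjugate f phi = Finite C -> is_in_F T phi.
Proof.
  intros Hphi HC; pose proof (Fbar_state phi Hphi) as Hst.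
  assert (HC0 : 0 <= C).
  { pose proof (conjugate_nonneg phi Hphi) as H; rewrite HC in H; exact H. }
  destruct (countably_additive phi (Fbar_superlinear phi Hphi)) as [p [Hp Heq]].
  - intros; rewrite (state_sadd _ Hst), (state_sscal _ Hst) by auto with linf; reflexivity.
  - intros eps Heps.
    assert (HK : 0 < (1 + C) / eps) by (apply Rdiv_lt_0_compat; lra).
    destruct (Htight (cst 0) _ (linf_cst 0) HK) as [n Hn]; exists n.
    pose proof (conjugate_ge phi (sadd (cst 0) (sscal (- ((1 + C) / eps)) (tail n)))
      ltac:(auto with linf)) as H.
    rewrite HC in H; simpl in H; rewrite (niv_0 f Hf) in Hn.
    rewrite (state_sadd _ Hst), (state_cst _ Hst), (state_sscal _ Hst) in H by auto with linf.
    rewrite (state_sscal _ Hst) by auto with linf.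
    replace (- eps) with ((- 1 - C) / ((1 + C) / eps)) by (field; lra).
    replace (-1 * phi (tail n)) with (- ((1 + C) / eps) * phi (tail n) / ((1 + C) / eps))
      by (field; lra).
    apply Rdiv_le_r; lra.
  - exists p; split; [split; [assumption|] | assumption].
    exists (phi (T (cst 1))); intros x Hx.
    rewrite <- !Heq by auto with linf; apply Fbar_eigenvalue; assumption.
Qed.

Lemma conjugate_good : good_cost T (conjugate f).
Proof.
  split; [exact conjugate_nonneg|split; [|split]].
  (* A supergradient at $0$ has cost $f(0)-0=0$. *)
  - intros eps Heps; destruct (conjugate_attained (cst 0) (linf_cst 0)) as [p [Hp Hc]].
    exists (fun y => pair y p); split; [apply inF_in_Fbar; assumption|].
    rewrite Hc, (niv_0 f Hf), (state_cst _ (pair_state p (proj1 Hp))); simpl; lra.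
  (* Lower semicontinuity of a supremum of continuous functions: the neighbourhood is given by one
     [y] exceeding [t], with the excess as radius. *)
  - intros phi _ t Ht; destruct (conjugate_lt phi t Ht) as [y [Hy Hty]].
    exists (y :: nil), (f y - phi y - t); split; [repeat constructor; assumption|].
    split; [lra|]; intros psi _ Hpsi.
    specialize (Hpsi y (or_introl eq_refl)); apply Rabs_lt_between in Hpsi.
    apply Rbar_lt_le_trans with (f y - psi y); [simpl; lra|].
    apply conjugate_ge; assumption.
  - intros phi Hphi Hn; pose proof (conjugate_nonneg phi Hphi) as H0.
    destruct (conjugate f phi) as [C | |] eqn:HC; [|reflexivity|contradiction].
    exfalso; apply Hn, (conjugate_finite_in_F phi C); assumption.
Qed.

Lemma conjugate_min_rep : is_min_rep T (conjugate f) f.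
Proof.
  intros x Hx; split.
  - destruct (conjugate_attained x Hx) as [p [Hp Hc]].
    exists (fun y => pair y p); split; [apply inF_in_Fbar; assumption|].
    rewrite Hc; simpl; f_equal; ring.
  - intros psi _; pose proof (conjugate_ge psi x Hx) as H.
    destruct (conjugate f psi); simpl in *; try tauto; lra.
Qed.
End Representation.

(** * From the axioms to a niveloid and back *)

(** Connectedness of $[0,1]$: the supremum [b] of the second set belongs to it by closedness. If [b]
    were not in the first set, then $b<1$ and points just to the right of [b] would lie in
    neither. *)
Lemma closed_cover (A B : R -> Prop) :
  closed_set (fun a => 0 <= a <= 1 /\ A a) -> closed_set (fun a => 0 <= a <= 1 /\ B a) ->
  A 1 -> B 0 -> (forall a, 0 <= a <= 1 -> A a \/ B a) -> exists a, A a /\ B a.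
Proof.
  intros HA HB HA1 HB0 Hcov.
  destruct (completeness (fun a => 0 <= a <= 1 /\ B a)) as [b [Hub Hlub]].
  { exists 1; intros a [Ha _]; apply Ha. }
  { exists 0; split; [lra | assumption]. }
  assert (Hb : 0 <= b <= 1).
  { split; [apply Hub; split; [lra | assumption]|].
    apply Hlub; intros a [Ha _]; apply Ha. }
  assert (HBb : B b).
  { apply NNPP; intro HnB.
    destruct (HB b) as [d Hd]; [intros [_ H]; exact (HnB H)|].
    pose proof (cond_pos d).
    apply (Rlt_not_le b (b - d / 2)); [lra|].
    apply Hlub; intros a Ha; apply Rnot_lt_le; intro Hlt.
    apply (Hd a); [|assumption].
    specialize (Hub a Ha); unfold disc; apply Rabs_lt_between; lra. }
  exists b; split; [|assumption]; apply NNPP; intro HnA.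
  assert (Hb1 : b < 1) by (destruct (Req_dec b 1); [subst; contradiction | lra]).
  destruct (HA b) as [d Hd]; [intros [_ H]; exact (HnA H)|].
  pose proof (cond_pos d).
  set (a := Rmin (b + d / 2) 1).
  assert (Ha : b < a <= 1 /\ a <= b + d / 2).
  { unfold a; repeat split; [apply Rmin_glb_lt; lra | apply Rmin_r | apply Rmin_l]. }
  destruct (Hcov a) as [HAa | HBa]; [lra | |].
  - apply (Hd a); [unfold disc; apply Rabs_lt_between; lra | split; [lra | assumption]].
  - assert (a <= b) by (apply Hub; split; [lra | assumption]); lra.
Qed.

Lemma decreasing_tail_set : decreasing_to_empty tail_set.
Proof.
  split.
  - intros n m; unfold tail_set; rewrite !Nat.leb_le; lia.
  - intro m; exists (S m); apply Nat.leb_gt; lia.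
Qed.

(** * The constant equivalent of a preference satisfying the axioms *)

Section Preference.
Variable pref : seqR -> seqR -> Prop.
Hypothesis Hax : all_axioms pref T.

Let Htrans : forall x y z, in_linf x -> in_linf y -> in_linf z ->
  pref x y -> pref y z -> pref x z.
Proof. apply Hax. Qed.

Let Htotal : forall x y, in_linf x -> in_linf y -> pref x y \/ pref y x.
Proof. apply Hax. Qed.

Let Hmono : forall x y, in_linf x -> in_linf y -> sge x y -> pref x y.
Proof. apply Hax. Qed.

Let Hicrp : icrp pref.
Proof. apply Hax. Qed.

Lemma sadd_cst s t : sadd (cst s) (cst t) = cst (s + t).
Proof. reflexivity. Qed.

(** If $d=t-s>0$, ICRP gives $0\succsim d$ and by iteration $0\succsim nd$ for all [n]; once
    $nd\ge1$ this contradicts $1\succ0$. *)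
Lemma pref_cst_le s t : pref (cst s) (cst t) -> t <= s.
Proof.
  intro Hst; apply Rnot_lt_le; intro Hlt.
  set (d := t - s).
  assert (Hd : pref (cst 0) (cst d)).
  { pose proof (Hicrp _ _ (- s) (linf_cst s) (linf_cst t) Hst) as H.
    rewrite !sadd_cst, Rplus_opp_r in H; exact H. }
  assert (Hn : forall n, pref (cst 0) (cst (INR n * d))).
  { induction n.
    - apply Hmono; auto with linf; intro; unfold cst; simpl; lra.
    - apply Htrans with (cst d); auto with linf.
      pose proof (Hicrp _ _ d (linf_cst 0) (linf_cst (INR n * d)) IHn) as H.
      rewrite !sadd_cst, Rplus_0_l in H.
      replace (INR (S n) * d) with (INR n * d + d) by (rewrite S_INR; ring); exact H. }
  destruct (INR_unbounded (/ d)) as [n Hnd].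
  destruct Hax as (_ & (_ & _ & Hneg) & _); apply Hneg.
  apply Htrans with (cst (INR n * d)); auto with linf.
  apply Hmono; auto with linf; intro; unfold cst.
  assert (0 < d) by (unfold d; lra).
  replace 1 with (/ d * d) by (field; lra).
  apply Rmult_le_compat_r; lra.
Qed.

(** Mixtures of the constants $M$ and $-M$ are constants. Those above [x] and those below [x] form
    closed sets covering $[0,1]$, hence share a point. *)
Lemma indifferent_constant x : in_linf x -> exists t, indiff pref x (cst t).
Proof.
  intro Hx; destruct (linf_bound x Hx) as [M [HM0 HM]].
  assert (HMx : pref (cst M) x) by (apply Hmono; auto with linf; intro n; apply HM).
  assert (HxM : pref x (cst (- M))) by (apply Hmono; auto with linf; intro n; apply HM).
  destruct Hax as (_ & _ & Hcont & _).
  destruct (Hcont (cst M) x (cst (- M)) ltac:(auto with linf) Hx ltac:(auto with linf) HMx HxM)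
    as [HA HB].
  destruct (closed_cover _ _ HA HB) as [a [Ha Hb]].
  - replace (smix 1 (cst M) (cst (- M))) with (cst M) by seq_ring; assumption.
  - replace (smix 0 (cst M) (cst (- M))) with (cst (- M)) by seq_ring; assumption.
  - intros a _; apply Htotal; auto with linf.
  - exists (a * M + (1 - a) * - M); split; [exact Hb | exact Ha].
Qed.

Lemma const_equiv_exists : exists I, const_equiv pref I.
Proof.
  destruct (@boolp.choice _ _ (fun x t => in_linf x -> indiff pref x (cst t))) as [I HI].
  { intro x; destruct (classic (in_linf x)) as [Hx | Hx].
    - destruct (indifferent_constant x Hx) as [t Ht]; exists t; auto.
    - exists 0; contradiction. }
  exists I; split; [exact HI|].
  intros x y Hx Hy; destruct (HI x Hx) as [H1 H2], (HI y Hy) as [H3 H4]; split.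
  - intro H; apply pref_cst_le.
    apply Htrans with x; auto with linf; apply Htrans with y; auto with linf.
  - intro H; apply Htrans with (cst (I x)); auto with linf.
    apply Htrans with (cst (I y)); auto with linf.
    apply Hmono; auto with linf; intro; exact H.
Qed.

Section ConstEquiv.
Variable I : seqR -> R.
Hypothesis HI : const_equiv pref I.

Let HIiff x y : in_linf x -> in_linf y -> (pref x y <-> I y <= I x).
Proof. apply HI. Qed.

Lemma const_equiv_unique J x : const_equiv pref J -> in_linf x -> J x = I x.
Proof.
  intros [HJ _] Hx; destruct (HJ x Hx) as [H1 H2], (proj1 HI x Hx) as [H3 H4].
  apply Rle_antisym; apply pref_cst_le; apply Htrans with x; auto with linf.
Qed.

Lemma const_equiv_cst t : I (cst t) = t.
Proof.
  destruct (proj1 HI (cst t) (linf_cst t)) as [H1 H2].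
  apply Rle_antisym; apply pref_cst_le; assumption.
Qed.

Lemma const_equiv_translation x t : in_linf x -> I (sadd x (cst t)) = I x + t.
Proof.
  intro Hx; destruct (proj1 HI x Hx) as [H1 H2].
  apply (Hicrp _ _ t) in H1, H2; auto with linf.
  rewrite sadd_cst in H1, H2.
  apply HIiff in H1, H2; auto with linf; rewrite const_equiv_cst in H1, H2; lra.
Qed.

Lemma const_equiv_niveloid : niveloid I.
Proof.
  split.
  - intros x y Hx Hy Hxy; apply HIiff; auto.
  - intros; apply const_equiv_translation; assumption.
  - apply const_equiv_cst.
  - intros x y a Hx Hy Ha.
    destruct Hax as (_ & _ & _ & _ & Hconv & _).
    (* Convexity alone concerns upper sets of constants. ICRP first moves [x] and [y] to the common
       level $0$, which upgrades it to concavity of [I]. *)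
    assert (H0 : forall z, in_linf z -> pref (sadd z (cst (- I z))) (cst 0)).
    { intros z Hz; apply HIiff; auto with linf.
      rewrite const_equiv_translation, const_equiv_cst by assumption; lra. }
    pose proof (Hconv _ _ 0 a (linf_sadd _ _ Hx (linf_cst (- I x)))
      (linf_sadd _ _ Hy (linf_cst (- I y))) Ha (H0 x Hx) (H0 y Hy)) as H.
    replace (smix a (sadd x (cst (- I x))) (sadd y (cst (- I y))))
      with (sadd (smix a x y) (cst (- (a * I x + (1 - a) * I y)))) in H by seq_ring.
    apply HIiff in H; auto with linf.
    rewrite const_equiv_translation, const_equiv_cst in H by auto with linf; lra.
  - intros x d Hx Hd Hle; apply HIiff; auto with linf.
    destruct Hax as (_ & _ & _ & _ & _ & _ & HTIS).
    apply HTIS; auto; apply HIiff; auto with linf.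
Qed.

Lemma const_equiv_tight : tight I.
Proof.
  intros x K Hx HK; destruct (linf_bound x Hx) as [M [HM0 HM]].
  pose proof const_equiv_niveloid as Hniv.
  destruct Hax as (_ & _ & _ & _ & _ & Hmc & _).
  (* Start from $x+1\succ I(x)$. The value $-(M+K)$ lies below $x-K$ everywhere, so the spliced
     sequence is below $x-K\,\mathrm{tail}_n+1$. *)
  destruct (Hmc (sadd x (cst 1)) (I x) tail_set ltac:(auto with linf)) with (k := - (M + K))
    as [n [Hn _]].
  - split; [apply HIiff | rewrite HIiff]; auto with linf;
      rewrite const_equiv_translation, const_equiv_cst by assumption; lra.
  - apply decreasing_tail_set.
  - exists n; apply HIiff in Hn; auto with linf.
    rewrite const_equiv_cst in Hn.
    cut (I (splice (tail_set n) (cst (- (M + K))) (sadd x (cst 1))) <=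
      I (sadd (sadd x (sscal (- K) (tail n))) (cst 1))).
    { rewrite (const_equiv_translation (sadd x _)) by auto with linf; lra. }
    apply (niv_mono I Hniv); auto with linf.
    intro m; unfold splice, sadd, sscal, tail, cst.
    specialize (HM m); destruct (tail_set n m); lra.
Qed.
End ConstEquiv.
End Preference.

(** * The axioms for the relation represented by a niveloid *)

Lemma niveloid_lipschitz f x y e : niveloid f -> in_linf x -> in_linf y ->
  (forall n, Rabs (x n - y n) <= e) -> Rabs (f x - f y) <= e.
Proof.
  intros Hf Hx Hy He; apply Rabs_le.
  pose proof (niv_mono f Hf (sadd y (cst e)) x ltac:(auto with linf) Hx) as H1.
  pose proof (niv_mono f Hf (sadd x (cst e)) y ltac:(auto with linf) Hy) as H2.
  rewrite (niv_cst f Hf) in H1, H2 by assumption.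
  split; [cut (f y <= f x + e); [lra | apply H2] | cut (f x <= f y + e); [lra | apply H1]];
    intro n; specialize (He n); apply Rabs_le_between in He; unfold sadd, cst; lra.
Qed.

Lemma closed_superlevel (h : R -> R) L v : 0 < L ->
  (forall a b, Rabs (h a - h b) <= L * Rabs (a - b)) ->
  closed_set (fun a => 0 <= a <= 1 /\ v <= h a).
Proof.
  intros HL Hh a Ha.
  destruct (classic (0 <= a <= 1)) as [Hin | Hout].
  - assert (Hlt : h a < v) by (apply Rnot_le_lt; intro; apply Ha; split; assumption).
    assert (Hd : 0 < (v - h a) / L) by (apply Rdiv_lt_0_compat; lra).
    exists (mkposreal _ Hd); intros b Hb [_ Hvb]; unfold disc in Hb; simpl in Hb.
    specialize (Hh b a); apply Rabs_le_between in Hh.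
    apply Rmult_lt_compat_l with (r := L) in Hb; [|assumption].
    replace (L * ((v - h a) / L)) with (v - h a) in Hb by (field; lra); lra.
  (* The radius is the distance from [a] to $[0,1]$. *)
  - assert (Hd : 0 < Rmax (- a) (a - 1)).
    { destruct (Rlt_le_dec a 0).
      - apply Rlt_le_trans with (- a); [lra | apply Rmax_l].
      - apply Rlt_le_trans with (a - 1); [lra | apply Rmax_r]. }
    exists (mkposreal _ Hd); intros b Hb [Hb01 _]; unfold disc in Hb; simpl in Hb.
    apply Rabs_lt_between in Hb; revert Hb; apply Rmax_case; lra.
Qed.

Lemma niveloid_continuity f : niveloid f -> Defs.continuity (fun x y => f y <= f x).
Proof.
  intros Hf x y z Hx Hy Hz _ _.
  destruct (linf_bound x Hx) as [M [HM0 HM]], (linf_bound z Hz) as [N [HN0 HN]].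
  assert (HL : forall a b, Rabs (f (smix a x z) - f (smix b x z)) <= (M + N) * Rabs (a - b)).
  { intros a b; apply niveloid_lipschitz; auto with linf; intro n.
    unfold smix; replace (_ - _) with ((x n - z n) * (a - b)) by ring.
    rewrite Rabs_mult; apply Rmult_le_compat_r; [apply Rabs_pos|].
    specialize (HM n); specialize (HN n); apply Rabs_le; lra. }
  split.
  - apply closed_superlevel with (M + N); [lra | exact HL].
  - assert (Hc : closed_set (fun a => 0 <= a <= 1 /\ - f y <= - f (smix a x z))).
    { apply closed_superlevel with (M + N); [lra|].
      intros a b; rewrite <- Rabs_Ropp.
      replace (- _) with (f (smix a x z) - f (smix b x z)) by ring; apply HL. }
    intros a Ha; destruct (Hc a) as [d Hd].
    + intros [H1 H2]; apply Ha; split; [assumption | lra].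
    + exists d; intros b Hb [H1 H2]; apply (Hd b Hb); split; [assumption | lra].
Qed.

Lemma niveloid_axioms f : niveloid f -> monotone_continuity (fun x y => f y <= f x) ->
  all_axioms (fun x y => f y <= f x) T.
Proof.
  intros Hf Hmc; repeat split.
  - intros x y _ _; lra.
  - intros x y z _ _ _; lra.
  - intros; apply (niv_mono f Hf); assumption.
  - rewrite !niv_const by assumption; lra.
  - rewrite !niv_const by assumption; lra.
  - apply niveloid_continuity; assumption.
  - apply niveloid_continuity; assumption.
  - intros x y t Hx Hy; rewrite !(niv_cst f Hf) by assumption; lra.
  - intros x y t a Hx Hy Ha Hxt Hyt.
    rewrite niv_const in * by assumption.
    apply Rle_trans with (2 := niv_conc f Hf x y a Hx Hy Ha); nra.
  - exact Hmc.
  - intros x d; apply (niv_T f Hf).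
Qed.

(** * Weak* compactness and monotone continuity *)

(** A free ultrafilter on $\mathbb N$, obtained by extending the filter [eventually]. *)
Lemma ultrafilter_exists : exists U : (nat -> Prop) -> Prop,
  (forall P Q : nat -> Prop, (forall n, P n -> Q n) -> U P -> U Q) /\
  (forall P Q, U P -> U Q -> U (fun n => P n /\ Q n)) /\
  (forall P, U P -> exists n, P n) /\
  (forall P, U P \/ U (fun n => ~ P n)) /\
  (forall N, U (fun n => (N <= n)%nat)).
Proof.
  destruct (filter.ultraFilterLemma (F := eventually)) as [U [HU Hev]].
  { apply filter.Build_ProperFilter.
    - intros [N HN]; exact (HN N (Nat.le_refl N)).
    - split.
      + exists O; intros; exact I.
      + intros P Q HP HQ; exact (filter_and P Q HP HQ).
      + intros P Q HPQ HP; exact (filter_imp P Q HPQ HP). }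
  pose proof (filter.ultra_proper (UltraFilter := HU)) as HP.
  pose proof (filter.filter_filter (ProperFilter := HP)) as HF.
  exists U; split; [|split; [|split; [|split]]].
  - intros P Q; apply (filter.filterS (Filter := HF)).
  - intros P Q; apply (filter.filterI (Filter := HF)).
  - intros P HUP; apply NNPP; intro Hn.
    apply (@filter.filter_not_empty nat U HP).
    refine (filter.filterS (Filter := HF) _ HUP); intros n Hp; apply Hn; exists n; exact Hp.
  - intro P; exact (filter.in_ultra_setVsetC P HU).
  - intro N; apply Hev; exists N; auto.
Qed.

(** Alaoglu's theorem, along an ultrafilter on the indices of the sequence. *)
Lemma Fbar_cluster (u : nat -> seqR -> R) : (forall n, in_Fbar T (u n)) ->
  exists phi, in_Fbar T phi /\ forall xs eps N, List.Forall in_linf xs -> 0 < eps ->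
    exists n, (N <= n)%nat /\ wnbhd xs eps phi (u n).
Proof.
  intro Hu; destruct ultrafilter_exists as [U (Hsup & Hand & Hne & Hor & Hev)].
  assert (Hlim : forall x, exists l, in_linf x ->
    forall eps, 0 < eps -> U (fun n => Rabs (u n x - l) < eps)).
  { intro x; destruct (classic (in_linf x)) as [Hx | Hx]; [|exists 0; contradiction].
    destruct (linf_bound x Hx) as [M [HM0 HM]].
    assert (HuM : forall n, - M <= u n x <= M).
    { intro n; apply Rabs_le_between, (state_bound _ (Fbar_state _ (Hu n))); [assumption|].
      intro m; apply Rabs_le, HM. }
    (* The limit along [U] is the supremum of the levels reached by [u n x] for [U]-almost all
       [n]. *)
    destruct (completeness (fun r => U (fun n => r <= u n x))) as [l [Hub Hlub]].
    - exists M; intros r Hr; destruct (Hne _ Hr) as [n Hn]; specialize (HuM n); lra.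
    - exists (- M); apply Hsup with (2 := Hev O); intros n _; apply HuM.
    - exists l; intros _ eps Heps.
      assert (H1 : exists r, l - eps < r /\ U (fun n => r <= u n x)).
      { apply NNPP; intro Hn; apply (Rlt_not_le l (l - eps)); [lra|].
        apply Hlub; intros r Hr; apply Rnot_lt_le; intro; apply Hn; exists r; auto. }
      destruct H1 as [r [Hr HUr]].
      assert (H2 : U (fun n => ~ l + eps / 2 <= u n x)).
      { destruct (Hor (fun n => l + eps / 2 <= u n x)) as [H | H]; [|exact H].
        specialize (Hub _ H); lra. }
      apply Hsup with (2 := Hand _ _ HUr H2); intros n [Ha Hb].
      apply Rnot_le_lt in Hb; apply Rabs_lt_between; lra. }
  destruct (@boolp.choice _ _ (fun x l => in_linf x ->
    forall eps, 0 < eps -> U (fun n => Rabs (u n x - l) < eps)) Hlim) as [phi Hphi].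
  assert (Hcl : forall xs eps N, List.Forall in_linf xs -> 0 < eps ->
    exists n, (N <= n)%nat /\ wnbhd xs eps phi (u n)).
  { intros xs eps N Hxs Heps; apply Hne, Hand; [apply Hev|].
    induction Hxs as [|x xs Hx Hxs IH].
    - apply Hsup with (2 := Hev O); intros n _ x [].
    - apply Hsup with (2 := Hand _ _ (Hphi x Hx eps Heps) IH).
      intros n [H1 H2] y [-> | Hy]; auto. }
  exists phi; split; [|exact Hcl].
  split; [split|].
  - intros x y a b Hx Hy.
    apply cond_eq; intros eps Heps.
    set (K := 1 + Rabs a + Rabs b).
    pose proof (Rabs_pos a); pose proof (Rabs_pos b).
    assert (He : 0 < eps / K) by (apply Rdiv_lt_0_compat; unfold K; lra).
    set (z := fun k => a * x k + b * y k).
    assert (Hz : in_linf z)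
      by (apply (linf_sadd (sscal a x) (sscal b y)); apply linf_sscal; assumption).
    destruct (Hcl (z :: x :: y :: nil) (eps / K) O ltac:(repeat constructor; assumption) He)
      as [n [_ Hn]].
    pose proof (Hn z ltac:(simpl; auto)) as Hnz.
    pose proof (Hn x ltac:(simpl; auto)) as Hnx.
    pose proof (Hn y ltac:(simpl; auto)) as Hny.
    pose proof (proj1 (proj1 (Hu n)) x y a b Hx Hy) as Hlin; fold z in Hlin.
    replace (phi z - (a * phi x + b * phi y))
      with (- (u n z - phi z) + (a * (u n x - phi x) + b * (u n y - phi y)))
      by (rewrite Hlin; ring).
    replace eps with (eps / K + (Rabs a * (eps / K) + Rabs b * (eps / K)))
      by (unfold K; field; unfold K in *; lra).
    apply Rle_lt_trans with (1 := Rabs_triang _ _).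
    rewrite Rabs_Ropp; apply Rplus_lt_le_compat; [assumption|].
    apply Rle_trans with (1 := Rabs_triang _ _); rewrite !Rabs_mult.
    apply Rplus_le_compat; apply Rmult_le_compat_l; lra.
  - exists 1; intros x M Hx HM; apply le_epsilon; intros eps Heps.
    destruct (Hcl (x :: nil) eps O ltac:(repeat constructor; assumption) Heps) as [n [_ Hn]].
    specialize (Hn x (or_introl eq_refl)).
    pose proof (state_bound _ (Fbar_state _ (Hu n)) x M Hx HM) as Hb.
    apply Rabs_le_between in Hb; apply Rabs_lt_between in Hn; apply Rabs_le; lra.
  (* A closure is closed: half of [eps] leads to some [u n], the other half from there to an element
     of $F$. *)
  - intros xs eps Hxs Heps.
    destruct (Hcl xs (eps / 2) O Hxs ltac:(lra)) as [n [_ Hn]].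
    destruct (proj2 (Hu n) xs (eps / 2) Hxs ltac:(lra)) as [p [Hp Hpn]].
    exists p; split; [assumption|]; intros x Hx.
    specialize (Hn x Hx); specialize (Hpn x Hx); simpl in Hpn.
    apply Rabs_lt_between in Hn, Hpn; apply Rabs_lt_between; lra.
Qed.

(** The pairing of [p] with $1-\mathrm{tail}_N$ is at least the head sum, which tends to $1$. *)
Lemma pair_tail_small p eps : in_Delta_sigma p -> 0 < eps ->
  exists N, pair (tail N) p < eps.
Proof.
  intros Hp Heps; pose proof (pair_state p Hp) as Hps.
  assert (Hl : is_lim_seq (sum_n p) 1) by exact (proj2 Hp).
  apply is_lim_seq_spec in Hl; destruct (Hl (mkposreal _ Heps)) as [N HN].
  specialize (HN N (Nat.le_refl N)); simpl in HN; apply Rabs_lt_between in HN.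
  (* [sum_n p N] includes the index [N], so the tail starts at [S N]. *)
  exists (S N).
  set (hd := sadd (cst 1) (sscal (-1) (tail (S N)))).
  assert (Hhd : pair hd p = 1 - pair (tail (S N)) p).
  { unfold hd; rewrite (state_sadd _ Hps), (state_sscal _ Hps), (state_cst _ Hps)
      by auto with linf; ring. }
  assert (Hle : sum_n (fun n => p n * hd n) N <= pair hd p).
  { apply (is_lim_seq_incr_compare (sum_n (fun n => p n * hd n))).
    - apply (Series_correct (fun n => p n * hd n)), ex_series_pair; [assumption|].
      unfold hd; auto with linf.
    - intro n; rewrite sum_Sn; unfold plus; simpl.
      cut (0 <= p (S n) * hd (S n)); [lra|].
      apply Rmult_le_pos; [apply Hp|].
      unfold hd, sadd, sscal, cst, tail; destruct (tail_set _ _); lra. }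
  assert (Hhd1 : forall n, (n <= N)%nat -> p n * hd n = p n).
  { intros n Hn; unfold hd, sadd, sscal, cst, tail, tail_set.
    rewrite (proj2 (Nat.leb_gt (S N) n)) by lia; ring. }
  rewrite (sum_n_ext_loc _ p N Hhd1) in Hle; lra.
Qed.

(** * From the minimum formula to the axioms *)

Section Converse.
Variables (c : (seqR -> R) -> Rbar) (I : seqR -> R).
Hypotheses (Hc : good_cost T c) (Hrep : is_min_rep T c I).

Lemma rep_le phi C x : in_Fbar T phi -> c phi = Finite C -> in_linf x -> I x <= phi x + C.
Proof.
  intros Hphi HC Hx; pose proof (proj2 (Hrep x Hx) phi Hphi) as H.
  rewrite HC in H; exact H.
Qed.

Lemma rep_attained x : in_linf x ->
  exists phi C, in_Fbar T phi /\ c phi = Finite C /\ I x = phi x + C.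
Proof.
  intro Hx; destruct (proj1 (Hrep x Hx)) as [phi [Hphi Heq]].
  destruct (c phi) as [C | |] eqn:HC; try discriminate.
  exists phi, C; split; [assumption|]; split; [assumption|]; injection Heq; auto.
Qed.

Lemma finite_cost_in_F phi C : in_Fbar T phi -> c phi = Finite C -> is_in_F T phi.
Proof.
  intros Hphi HC; apply NNPP; intro Hn; destruct Hc as (_ & _ & _ & Hinf).
  rewrite (Hinf phi Hphi Hn) in HC; discriminate.
Qed.

(** Every functional vanishes at $0$, so this value is the infimum of the grounded cost. *)
Lemma rep_0 : I (cst 0) = 0.
Proof.
  destruct Hc as (Hpos & Hgr & _).
  apply Rle_antisym.
  - apply le_epsilon; intros eps Heps; destruct (Hgr eps Heps) as [phi [Hphi Hlt]].
    specialize (Hpos phi Hphi).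
    destruct (c phi) as [C | |] eqn:HC; simpl in *; try contradiction.
    pose proof (rep_le phi C (cst 0) Hphi HC (linf_cst 0)) as H.
    rewrite (state_cst _ (Fbar_state phi Hphi)) in H; lra.
  - destruct (rep_attained (cst 0) (linf_cst 0)) as (phi & C & Hphi & HC & Heq).
    specialize (Hpos phi Hphi); rewrite HC in Hpos; simpl in Hpos.
    rewrite (state_cst _ (Fbar_state phi Hphi)) in Heq; lra.
Qed.

(** In each inequality a minimizer is taken at the point whose value is bounded from below and
    serves as an upper bound at the other points. *)
Lemma rep_niveloid : (forall p, inF T p -> pair (T (cst 1)) p <= 1) -> niveloid I.
Proof.
  intro HT1; split.
  - intros x y Hx Hy Hxy.
    destruct (rep_attained x Hx) as (phi & C & Hphi & HC & ->).
    pose proof (rep_le phi C y Hphi HC Hy).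
    pose proof (state_mono _ (Fbar_state phi Hphi) x y Hx Hy Hxy); lra.
  - assert (Hle : forall x t, in_linf x -> I (sadd x (cst t)) <= I x + t).
    { intros x t Hx; destruct (rep_attained x Hx) as (phi & C & Hphi & HC & ->).
      pose proof (Fbar_state phi Hphi) as Hst.
      pose proof (rep_le phi C (sadd x (cst t)) Hphi HC ltac:(auto with linf)) as H.
      rewrite (state_sadd _ Hst), (state_cst _ Hst) in H by auto with linf; lra. }
    intros x t Hx; apply Rle_antisym; [apply Hle; assumption|].
    pose proof (Hle (sadd x (cst t)) (- t) ltac:(auto with linf)) as H.
    replace (sadd (sadd x (cst t)) (cst (- t))) with x in H by seq_ring; lra.
  - exact rep_0.
  - intros x y a Hx Hy Ha.
    destruct (rep_attained (smix a x y) ltac:(auto with linf)) as (phi & C & Hphi & HC & ->).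
    pose proof (Fbar_state phi Hphi) as Hst.
    rewrite smix_sadd, (state_sadd _ Hst), !(state_sscal _ Hst) by auto with linf.
    pose proof (rep_le phi C x Hphi HC Hx); pose proof (rep_le phi C y Hphi HC Hy); nra.
  - (* With l the eigenvalue of the minimizing p at x + T d, which lies in [0, 1],
       <x + T d, p> = (1 - l) <x, p> + l <x + d, p>. *)
    intros x d Hx Hd Hle.
    destruct (rep_attained (sadd x (T d)) ltac:(auto with linf)) as (phi & C & Hphi & HC & ->).
    pose proof (Fbar_state phi Hphi) as Hst.
    destruct (finite_cost_in_F phi C Hphi HC) as [p [Hp Heq]].
    pose proof (HT1 p Hp) as Hl1; rewrite <- Heq in Hl1 by auto with linf.
    assert (Hl0 : 0 <= phi (T (cst 1))).
    { apply (st_pos _ Hst); auto with linf.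
      destruct HT as (_ & _ & HP & _); apply HP; auto with linf; intro; unfold cst; lra. }
    pose proof (rep_le phi C x Hphi HC Hx) as H1.
    pose proof (rep_le phi C (sadd x d) Hphi HC ltac:(auto with linf)) as H2.
    rewrite (state_sadd _ Hst) in * by auto with linf.
    rewrite (Fbar_eigenvalue phi d Hphi Hd); nra.
Qed.

(** Each of the finitely many indices below [N] leaves the decreasing sets for good. *)
Lemma decreasing_head_false E N : decreasing_to_empty E ->
  exists n0, forall n j, (n0 <= n)%nat -> (j < N)%nat -> E n j = false.
Proof.
  intros [Hdec Hemp].
  assert (Hstay : forall n m j, (n <= m)%nat -> E n j = false -> E m j = false).
  { intros n m j Hnm Hn; induction Hnm as [|m Hnm IH]; [assumption|].
    destruct (E (S m) j) eqn:Hm; [|reflexivity].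
    rewrite (Hdec _ _ Hm) in IH; discriminate. }
  induction N as [|N [n1 IH]].
  - exists O; intros; lia.
  - destruct (Hemp N) as [n2 Hn2]; exists (Nat.max n1 n2); intros n j Hn Hj.
    destruct (Nat.eq_dec j N) as [-> | Hne].
    + apply Hstay with n2; [lia | assumption].
    + apply IH; lia.
Qed.

Lemma decreasing_monotone (E : nat -> nat -> bool) n m j : decreasing_to_empty E -> (n <= m)%nat ->
  E m j = true -> E n j = true.
Proof. intros [Hdec _] Hnm; induction Hnm; auto. Qed.

(** Minimizers $\varphi_n$ at $y_n$ have costs at most $\theta+B$, so by lower semicontinuity a
    cluster point has finite cost. For $n\ge m$ one has $\varphi_n(y_m)\le\varphi_n(y_n)$, which
    carries the bound by $\theta$ at a fixed $y_m$ to the cluster point. *)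
Lemma cluster_cost (y : nat -> seqR) theta B :
  (forall n, in_linf (y n)) -> (forall n m, (n <= m)%nat -> sge (y m) (y n)) ->
  (forall n j, - B <= y n j) -> (forall n, I (y n) <= theta) ->
  exists phi C, in_Fbar T phi /\ c phi = Finite C /\ forall n, phi (y n) + C <= theta.
Proof.
  intros Hy Hincr HB Hth.
  destruct (@boolp.choice nat _ (fun n (q : (seqR -> R) * R) => in_Fbar T (fst q) /\
    c (fst q) = Finite (snd q) /\ I (y n) = fst q (y n) + snd q)) as [q Hq].
  { intro n; destruct (rep_attained (y n) (Hy n)) as (phi & C & H); exists (phi, C); exact H. }
  destruct (Fbar_cluster (fun n => fst (q n))) as [phi [Hphi Hcl]]; [intro; apply Hq|].
  destruct Hc as (Hpos & _ & Hlsc & _).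
  assert (Hle : Rbar_le (c phi) (theta + B)).
  { apply Rbar_not_lt_le; intro Hlt.
    destruct (Hlsc phi Hphi _ Hlt) as (xs & eps & Hxs & Heps & Hnb).
    destruct (Hcl xs eps O Hxs Heps) as [n [_ Hw]].
    destruct (Hq n) as (H1 & H2 & H3); specialize (Hth n).
    specialize (Hnb _ H1 Hw); rewrite H2 in Hnb; simpl in Hnb.
    pose proof (Fbar_state _ H1) as Hst.
    pose proof (state_mono _ Hst (y n) (cst (- B)) (Hy n) (linf_cst _) (HB n)) as H.
    rewrite (state_cst _ Hst) in H; lra. }
  pose proof (Hpos phi Hphi) as H0.
  destruct (c phi) as [C | |] eqn:HC; simpl in Hle, H0; try contradiction.
  exists phi, C; split; [assumption|]; split; [assumption|]; intro m.
  apply Rnot_lt_le; intro Hlt.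
  (* Going from [phi] to a nearby minimizer loses less than $D/2$ in cost and less than $D/2$ at
     [y m], so its sum still exceeds [theta]. *)
  set (D := phi (y m) + C - theta).
  assert (HD : 0 < D) by (unfold D; lra).
  destruct (Hlsc phi Hphi (C - D / 2)) as (xs & eps & Hxs & Heps & Hnb).
  { rewrite HC; simpl; lra. }
  destruct (Hcl (y m :: xs) (Rmin eps (D / 2)) m) as [n [Hmn Hw]].
  { constructor; [apply Hy | assumption]. }
  { apply Rmin_glb_lt; lra. }
  destruct (Hq n) as (H1 & H2 & H3); specialize (Hth n).
  assert (Hn : Rbar_lt (C - D / 2) (c (fst (q n)))).
  { apply Hnb; [assumption|]; intros x Hx.
    apply Rlt_le_trans with (1 := Hw x (or_intror Hx)), Rmin_l. }
  rewrite H2 in Hn; simpl in Hn.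
  pose proof (Rlt_le_trans _ _ _ (Hw (y m) (or_introl eq_refl)) (Rmin_r _ _)) as Hm.
  apply Rabs_lt_between in Hm.
  pose proof (state_mono _ (Fbar_state _ H1) (y n) (y m) (Hy n) (Hy m) (Hincr m n Hmn)).
  unfold D in *; lra.
Qed.

Lemma rep_monotone_continuity : niveloid I -> monotone_continuity (fun x y => I y <= I x).
Proof.
  intros Hniv x theta E Hx [_ Hlt] HE k.
  rewrite niv_const in Hlt by assumption.
  destruct (linf_bound x Hx) as [M [HM0 HM]].
  (* The filler $-B$ lies below both [k] and [x]: the spliced sequences then increase with [n] and
     stay below those filled with [k]. *)
  set (B := M + Rabs k).
  pose proof (Rabs_pos k); pose proof (Rle_abs (- k)) as Hk; rewrite Rabs_Ropp in Hk.
  set (y := fun n => splice (E n) (cst (- B)) x).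
  assert (Hy : forall n, in_linf (y n)) by (intro; unfold y; auto with linf).
  apply NNPP; intro Hno.
  destruct (cluster_cost y theta B) as (phi & C & Hphi & HC & Hth); [assumption | | | |].
  - intros n m Hnm j; unfold y, splice, cst; specialize (HM j).
    destruct (E m j) eqn:Hm; [rewrite (decreasing_monotone E n m j HE Hnm Hm); lra|].
    destruct (E n j); unfold B; lra.
  - intros n j; unfold y, splice, cst, B; specialize (HM j); destruct (E n j); lra.
  - intro n; apply Rnot_lt_le; intro Hn; apply Hno; exists n.
    assert (I (y n) <= I (splice (E n) (cst k) x)).
    { apply (niv_mono I Hniv); auto with linf.
      intro j; unfold y, splice, cst, B; destruct (E n j); lra. }
    split; rewrite niv_const by assumption; lra.
  - destruct (finite_cost_in_F phi C Hphi HC) as [p [Hp Heq]].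
    pose proof (pair_state p (proj1 Hp)) as Hps.
    destruct (pair_tail_small p ((I x - theta) / (2 * B)) (proj1 Hp)) as [N HN].
    { apply Rdiv_lt_0_compat; unfold B; lra. }
    destruct (decreasing_head_false E N HE) as [n Hn].
    specialize (Hth n); rewrite Heq in Hth by apply Hy.
    pose proof (rep_le phi C x Hphi HC Hx) as HIx; rewrite Heq in HIx by assumption.
    (* Before [N] the set [E n] is empty and [y n] equals [x]; from [N] on, adding $2B$ lifts even
       the filler $-B$ above [x]. The tail mass of [p] makes this correction smaller than
       $I(x)-\theta$. *)
    assert (Hdom : pair x p <= pair (sadd (y n) (sscal (2 * B) (tail N))) p).
    { apply (state_mono _ Hps); auto with linf.
      intro j; specialize (HM j); unfold y, sadd, sscal, splice, cst, tail, tail_set.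
      destruct (Nat.leb_spec N j) as [Hj | Hj].
      - destruct (E n j); unfold B; lra.
      - rewrite (Hn n j (Nat.le_refl n) Hj); lra. }
    rewrite (state_sadd _ Hps), (state_sscal _ Hps) in Hdom by auto with linf.
    assert (HB : 0 < 2 * B) by (unfold B; lra).
    apply Rmult_lt_compat_l with (r := 2 * B) in HN; [|assumption].
    replace (2 * B * ((I x - theta) / (2 * B))) with (I x - theta) in HN by (field; lra).
    lra.
Qed.
End Converse.

End Operator.

Theorem theorem4 :
  forall (T : seqR -> seqR), cont_pos_linear T ->
  (forall pref : seqR -> seqR -> Prop, all_axioms pref T ->
     exists (c : (seqR -> R) -> Rbar) (I : seqR -> R),
       good_cost T c /\ is_min_rep T c I /\ const_equiv pref I /\
       (forall J, const_equiv pref J -> forall x, in_linf x -> J x = I x)) /\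
  (forall (c : (seqR -> R) -> Rbar) (I : seqR -> R),
     good_cost T c -> is_min_rep T c I ->
     (forall p, inF T p -> pair (T (cst 1)) p <= 1) ->
     all_axioms (fun x y => I y <= I x) T).
Proof.
  intros T HT; split.
  - intros pref Hax; destruct (const_equiv_exists T pref Hax) as [I HI].
    pose proof (const_equiv_niveloid T HT pref Hax I HI) as Hniv.
    pose proof (const_equiv_tight T HT pref Hax I HI) as Htight.
    exists (conjugate I), I; split; [|split; [|split]].
    + apply conjugate_good; assumption.
    + apply conjugate_min_rep; assumption.
    + exact HI.
    + intros J HJ x Hx; exact (const_equiv_unique T pref Hax I HI J x HJ Hx).
  - intros c I Hc Hrep HT1.
    pose proof (rep_niveloid T HT c I Hc Hrep HT1) as Hniv.
    apply niveloid_axioms; [assumption..|].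
    apply (rep_monotone_continuity T c I Hc Hrep Hniv).
Qed.
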